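(* Let $T:[0,1)\to[0,1)$ be a GIET, let $[0,1)=D\sqcup\bigsqcup_{i=1}^kR_i$ be a dynamical decomposition with tower structure of $T$ (as defined in the context), with $q$ quasiminimal domains, indexed so that these are $R_1,\dots,R_q$, and let $T_1,\dots,T_q$ be the associated base g-GIETs, $T_i$ having $d_i$ intervals. Then the number $\mathcal E_T$ of non-atomic ergodic invariant probability measures for $T$ is finite and $$\mathcal E_T\le\sum_{i=1}^q\left[\frac{d_i}{2}\right],$$ where $[x]$ denotes the integer part of $x$.
   Context: A Borel measure $\mu$ on $[0,1)$ is non-atomic if $\mu(\{x\})=0$ for every $x$. Fix a regularity $r\ge1$. A right-open interval is an interval $[a,b)$, $a<b$. g-GIETs. A ($C^r$-)generalized interval exchange transformation with gaps (g-GIET) on $d\ge 1$ intervals is a map $T:I^t\to I^b$ with $I^t,I^b\subset[0,1)$, together with decompositions $I^t=\bigsqcup_{\alpha\in\mathcal A}I^t_\alpha$ and $I^b=\bigsqcup_{\alpha\in\mathcal A}I^b_\alpha$, $|\mathcal A|=d$, into right-open intervals (top and bottom intervals), such that for each $\alpha$ the restriction $T|_{I^t_\alpha}$ is an orientation-preserving $C^r$-diffeomorphism onto $I^b_\alpha$ which extends to a $C^r$-diffeomorphism between the closures. The connected components of $[0,1)\setminus I^t$ (resp. $[0,1)\setminus I^b$) are the top (resp. bottom) gaps. A GIET is a g-GIET with $I^t=I^b=[0,1)$. An IET is a GIET all of whose branches are translations; it is minimal if all its orbits are dense. Orbits. For $x\in I^t$, $T^n(x)$ ($n\ge1$) is defined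 as long as $x,\dots,T^{n-1}(x)\in I^t$, and $T^{-n}(x)$ as long as $x,\dots,T^{-(n-1)}(x)\in I^b$. $\mathcal O^\pm(x)$ consists of $x$ and all its defined forward (resp. backward) iterates, $\mathcal O(x)=\mathcal O^+(x)\cup\mathcal O^-(x)$. The orbit is regular if $\mathcal O(x)\subset I^t\cap I^b$; periodic if regular and finite (period = cardinality); transient if it is finite, its last defined forward iterate lies in a top gap and its last defined backward iterate lies in a bottom gap. For infinite $\mathcal O^{+}(x)$ (resp. $\mathcal O^-(x)$), $\omega(x)$ (resp. $\alpha(x)$) is its set of accumulation points in $I^t$. Periodic orbits are trivially recurrent; an infinite regular orbit is non-trivially recurrent if $x\in\omega(x)\cap\alpha(x)$; recurrent means one of the two. A quasiminimal is the closure in $I^t$ of a non-trivially recurrent orbit. Endpoints. Let $\overline T$ be the left-open g-GIET obtained by restricting $T$ to the interiors of the $I^t_\alpha$ and extending by continuity to right endpoints. ''Periodic orbit (possibly at an endpoint)'' means a periodic orbit of $T$, or a periodic orbit of $\overline T$ containing a right endpoint of an interval; similarly for fixed points. Restrictions and domains. If $J\subset I^t$ is a finite union of right-open intervals, $T|_J:J\to T(J)$ is the g-GIET whose top intervals are the connected components of the sets $J\cap I^t_\alpha$ and whose bottom intervals are their images. $J$ is a domain of transition if every $x\in J$ has transient orbit under $T|_J$; a domain of recurrence if no $x\in J$ does. Tower representation. Let $\tilde T:\tilde I^t\to\tilde I^b$ be a g-GIET with intervals $\tilde I^t_\beta,\tilde I^b_\beta$, $\beta\in\mathcal B$, $\tilde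 I^t\subset I^t$, $\tilde I^b\subset I^b$. $R$ is a tower representation of $T$ over $\tilde T$ if there are positive integers $(n_\beta)$ such that for each $\beta$ the intervals $\tilde I^t_\beta,T(\tilde I^t_\beta),\dots,T^{n_\beta-1}(\tilde I^t_\beta)$ are pairwise disjoint and contained in $I^t$, $\tilde T=T^{n_\beta}$ on $\tilde I^t_\beta$, and $R$ is the disjoint union over $\beta$ of the towers $\bigcup_{j=0}^{n_\beta-1}T^j(\tilde I^t_\beta)$. Rauzy–Veech (RV) induction. Let $T$ be a g-GIET on $d\ge1$ intervals; bijections $\pi_t,\pi_b:\mathcal A\to\{1,\dots,d\}$ record the left-to-right order of the top and bottom intervals, $\pi=(\pi_t,\pi_b)$. Let $\alpha_t=\pi_t^{-1}(d)$, $\alpha_b=\pi_b^{-1}(d)$, $I^t_{\alpha_t}=[l^t,r^t)$, $I^b_{\alpha_b}=[l^b,r^b)$. One RV step produces the first return map $T^{(1)}$ of $T$ to $[0,\lambda^{(1)})$, with intervals $I^{t,1}_\alpha$ and $I^{b,1}_\alpha=T^{(1)}(I^{t,1}_\alpha)$: Case 1 ($r^t=r^b$): $\lambda^{(1)}=\max(l^t,l^b)$. Case 1a: if $l^t<l^b$, $\alpha_t$ wins and $\alpha_b$ loses, $I^{t,1}_\alpha=I^t_\alpha\cap[0,l^b)$, $T^{(1)}=T$ on $I^{t,1}_\alpha$ for $\alpha\ne\alpha_b$ and $T^{(1)}=T^2$ on $I^{t,1}_{\alpha_b}$; if $l^t>l^b$, $\alpha_b$ wins and $\alpha_t$ loses,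 $I^{t,1}_\alpha=T^{-1}(I^b_\alpha\cap[0,l^t))$ with $T^{(1)}=T$ for $\alpha\neq\alpha_t$, and $I^{t,1}_{\alpha_t}=T^{-1}(I^b_{\alpha_b}\cap[l^t,1))$ with $T^{(1)}=T^2$. Case 1b: if $l^t=l^b$, neither wins, the letter $\alpha_t$ is removed, other top intervals are unchanged, $T^{(1)}=T$ except $T^{(1)}=T^2$ on $I^t_{\alpha_b}$. (If $\alpha_t=\alpha_b$ in Case 1, no point of this interval returns and the letter is removed.) Case 2 ($r^t\ne r^b$). Case 2a: if $\max(l^t,l^b)<\min(r^t,r^b)$, $\lambda^{(1)}=\min(r^t,r^b)$; if $r^t>r^b$, $\alpha_t$ wins (against a gap) and $I^{t,1}_\alpha=I^t_\alpha\cap[0,r^b)$; if $r^b>r^t$, $\alpha_b$ wins (against a gap) and $I^{t,1}_\alpha=T^{-1}(I^b_\alpha\cap[0,r^t))$; $T^{(1)}=T$. Case 2b: otherwise, $\lambda^{(1)}=\max(l^t,l^b)$; if $r^t<r^b$ a top gap wins and $\alpha_b$ loses and is removed; if $r^t>r^b$ a bottom gap wins and $\alpha_t$ loses and is removed; $T^{(1)}=T$ on the remaining intervals. A letter plays at a step if it wins or loses, or if it is $\alpha_t$ or $\alpha_b$ in Case 1b. $T$ is infinitely renormalizable if, iterating, the number of intervals never becomes $0$. $T$ is RV-stable if it is infinitely renormalizable and each $\alpha\in\mathcal A$ either never plays, or plays infinitely often and then either only wins, or only loses, or both wins and loses infinitely often. For RV-stable $T$ the combinatorial rotation number is $(\pi,\gamma)$,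 $\gamma=\alpha_1\alpha_2\cdots$, with $\alpha_i$ the letter winning at the $i$-th step; it is infinite complete if every letter appears infinitely often in $\gamma$. When a g-GIET is compared with an IET, ''same combinatorial rotation number'' means that the permutations agree and the sequences $\gamma$ agree after deleting the letters corresponding to wins against gaps. Semi-conjugacy. $T:I^t\to I^b$ is semi-conjugated to $T_0:I_0^t\to I_0^b$ if there is a continuous, monotone, surjective $h:I^t\to I_0^t$ with $T_0\circ h(x)=h\circ T(x)$ for all $x\in I^t$ with $T(x)\in I^t$. Dynamical decomposition with tower structure (every GIET admits one). This is a partition $[0,1)=D\sqcup\bigsqcup_{i=1}^kR_i$ into finite unions of right-open intervals, with $D$ a domain of transition and each $R_i$ a domain of recurrence such that $T|_{R_i}$ is in exactly one of two cases: (1) [$R_i$ is a periodic domain] there exists a periodic orbit (possibly at an endpoint) and all recurrent orbits are periodic of the same period; (2) [$R_i$ is a quasiminimal domain] there exists a unique quasiminimal and all recurrent orbits are non-trivially recurrent; and such that each $R_i$ is a tower representation of $T$ over a base g-GIET $T_i$ on $d_i$ intervals where: in case (1), $d_i=1$ and $T_i$ is a $C^r$-diffeomorphism on its domain with at least one fixed point (possibly at an endpoint) and whose recurrent orbits are all fixed points; in case (2), $d_i>1$, the combinatorial rotation number of $T_i$ is infinite complete and $T_i$ is semi-conjugated to a minimal IET with the same combinatorial rotation number (hence with $d_i$ intervals). *)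

(* Defs.v *)
From HB Require Import structures.
From mathcomp Require Import all_boot all_order all_algebra.
From mathcomp Require Import all_classical all_reals all_analysis.
Set Implicit Arguments.
Unset Strict Implicit.
Unset Printing Implicit Defensive.
Import Order.TTheory GRing.Theory Num.Theory.
Import numFieldNormedType.Exports.
Local Open Scope classical_set_scope.
Local Open Scope ring_scope.

Section Regularity.
Variable R : realType.

Definition Ck (k : nat) (f : R -> R) : Prop :=
  (forall j x, (j < k)%N -> derivable (derive1n j f) x 1) /\ continuous (derive1n k f).

Definition locally_Holder (a : R) (f : R -> R) : Prop :=
  forall M : R, exists C : R, forall x y : R, `|x| <= M -> `|y| <= M ->
    `|f x - f y| <= C * `|x - y| `^ a.

(* For finite r = k + a with k natural and 0 < a < 1, C^r means C^k with a
   locally a-Hoelder k-th derivative; r = +oo means smooth. *)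
Definition Cr (r : \bar R) (f : R -> R) : Prop :=
  (forall k : nat, (k%:R%:E <= r)%E -> Ck k f) /\
  (forall (k : nat) (s : R), r = s%:E -> k%:R < s < k.+1%:R ->
     locally_Holder (s - k%:R) (derive1n k f)).

(* f maps [a, b[ onto [c, d[ and extends to an increasing C^r-diffeomorphism
   from [a, b] onto [c, d].  As usual for maps on closed intervals, being C^r
   up to the boundary means being the restriction of a C^r map on R. *)
Definition Cr_diffeo_ext (r : \bar R) (f : R -> R) (a b c d : R) : Prop :=
  exists F G : R -> R,
    [/\ Cr r F /\ Cr r G,
        (forall x, a <= x < b -> f x = F x),
        (forall x y, a <= x -> x < y -> y <= b -> F x < F y),
        F @` `[a, b]%classic = `[c, d]%classic &
        (forall x, a <= x <= b -> G (F x) = x) /\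
        (forall y, c <= y <= d -> F (G y) = y)].

End Regularity.

(* Raw data of a g-GIET whose intervals are labelled by a subset of A (Rauzy-
   Veech induction may remove letters): top interval [tl a, tr a[, bottom
   interval [bl a, br a[.  The values of gmap outside the top intervals and
   the endpoints at inactive letters are irrelevant. *)
Record gGIET (R : realType) (A : finType) := GGIET {
  letters : {set A};
  tl : A -> R;
  tr : A -> R;
  bl : A -> R;
  br : A -> R;
  gmap :> R -> R
}.

Section GGIET.
Variables (R : realType) (A : finType).
Implicit Types T : gGIET R A.

Definition topI T (a : A) : set R := `[tl T a, tr T a[%classic.
Definition botI T (a : A) : set R := `[bl T a, br T a[%classic.
Definition Itop T : set R := \bigcup_(a in [set` letters T]) topI T a.
Definition Ibot T : set R := \bigcup_(a in [set` letters T]) botI T a.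

Definition is_gGIET (r : \bar R) T : Prop :=
  [/\ letters T != finset.set0,
      (forall a, a \in letters T -> 0 <= tl T a /\ tl T a < tr T a <= 1),
      (forall a, a \in letters T -> 0 <= bl T a /\ bl T a < br T a <= 1),
      trivIset [set` letters T] (topI T) /\
      trivIset [set` letters T] (botI T) &
      (forall a, a \in letters T ->
         Cr_diffeo_ext r T (tl T a) (tr T a) (bl T a) (br T a))].

Definition is_GIET (r : \bar R) T : Prop :=
  [/\ is_gGIET r T, Itop T = `[0, 1[%classic & Ibot T = `[0, 1[%classic].

Definition is_IET (r : \bar R) T : Prop :=
  is_GIET r T /\
  (forall a, a \in letters T -> exists c : R, forall x, topI T a x -> T x = x + c).

End GGIET.

(* An injective map pfun from pdom onto pim, seen as a partial map of [0, 1].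
   This is what orbit notions depend on; it is used for T and for its
   left-open version. *)
Record partial_map (R : realType) := PMap {
  pdom : set R;
  pim : set R;
  pfun : R -> R
}.

Section Orbits.
Variable R : realType.
Implicit Types P : partial_map R.

(* P^n(x) is defined and equal to y; equivalently P^(-n)(y) is defined and
   equal to x. *)
Definition iterates P (n : nat) (x y : R) : Prop :=
  (forall j, (j < n)%N -> pdom P (iter j (pfun P) x)) /\ iter n (pfun P) x = y.

Definition fwd_orbit P (x : R) : set R := [set y | exists n, iterates P n x y].
Definition bwd_orbit P (x : R) : set R := [set y | exists n, iterates P n y x].
Definition full_orbit P (x : R) : set R := fwd_orbit P x `|` bwd_orbit P x.

Definition regular_orbit P (x : R) : Prop :=
  full_orbit P x `<=` pdom P `&` pim P.

Definition periodic_orbit P (x : R) : Prop :=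
  regular_orbit P x /\ finite_set (full_orbit P x).

Definition has_period P (p : nat) (x : R) : Prop :=
  regular_orbit P x /\ (full_orbit P x #= `I_p)%card.

(* The points of [0, 1[ outside pdom (resp. pim) are those lying in a top
   (resp. bottom) gap; an iterate outside pdom is necessarily the last one. *)
Definition transient_orbit P (x : R) : Prop :=
  [/\ finite_set (full_orbit P x),
      (exists2 y, fwd_orbit P x y & (`[0, 1[%classic `\` pdom P) y) &
      (exists2 z, bwd_orbit P x z & (`[0, 1[%classic `\` pim P) z)].

Definition omega_set P (x : R) : set R := limit_point (fwd_orbit P x) `&` pdom P.
Definition alpha_set P (x : R) : set R := limit_point (bwd_orbit P x) `&` pdom P.

Definition nontrivially_recurrent P (x : R) : Prop :=
  [/\ regular_orbit P x, infinite_set (full_orbit P x),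
      omega_set P x x & alpha_set P x x].

Definition recurrent_orbit P (x : R) : Prop :=
  periodic_orbit P x \/ nontrivially_recurrent P x.

Definition quasiminimal P (Q : set R) : Prop :=
  exists2 x, nontrivially_recurrent P x & Q = closure (full_orbit P x) `&` pdom P.

Definition fixed_point P (x : R) : Prop := pdom P x /\ pfun P x = x.

End Orbits.

Section GGIETDynamics.
Variables (R : realType) (A : finType).
Implicit Types T : gGIET R A.

Definition right_open T : partial_map R := PMap (Itop T) (Ibot T) T.

(* The left-open g-GIET: inside a branch T is continuous, so its left limit is
   T itself, and at a right endpoint the left limit is the extension by
   continuity of the branch ending there. *)
Definition left_open T : partial_map R :=
  PMap (\bigcup_(a in [set` letters T]) `]tl T a, tr T a]%classic)
       (\bigcup_(a in [set` letters T]) `]bl T a, br T a]%classic)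
       (fun x => lim (T y @[y --> x^'-])).

Definition right_endpoint T (x : R) : Prop :=
  exists2 a, a \in letters T & x = tr T a \/ x = br T a.

Definition periodic_possibly_at_endpoint T : Prop :=
  (exists x, periodic_orbit (right_open T) x) \/
  (exists x y, [/\ periodic_orbit (left_open T) x,
                   full_orbit (left_open T) x y & right_endpoint T y]).

Definition fixed_possibly_at_endpoint T : Prop :=
  (exists x, fixed_point (right_open T) x) \/
  (exists2 x, fixed_point (left_open T) x & right_endpoint T x).

Definition minimal T : Prop :=
  forall x, `[0, 1[%classic x ->
    `[0, 1[%classic `<=` closure (full_orbit (right_open T) x).

End GGIETDynamics.

Definition right_open_union (R : realType) (J : set R) : Prop :=
  exists s : seq (R * R), (forall p, p \in s -> p.1 < p.2) /\
    J = \bigcup_(p in [set` s]) `[p.1, p.2[%classic.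

Section Restriction.
Variables (R : realType) (A : finType).
Implicit Types T : gGIET R A.

(* TJ is T|_J; it is unique up to relabelling of its intervals. *)
Definition is_restriction T (J : set R) (B : finType) (TJ : gGIET R B) : Prop :=
  [/\ J `<=` Itop T,
      (forall b, b \in letters TJ -> exists a x,
         [/\ a \in letters T, (J `&` topI T a) x,
             topI TJ b = connected_component (J `&` topI T a) x &
             botI TJ b = T @` topI TJ b]),
      {in letters TJ &, injective (topI TJ)},
      (forall a x, a \in letters T -> (J `&` topI T a) x ->
         exists2 b, b \in letters TJ &
           topI TJ b = connected_component (J `&` topI T a) x) &
      (forall x, J x -> TJ x = T x)].

Definition domain_of_transition T (J : set R) : Prop :=
  right_open_union J /\
  exists (B : finType) (TJ : gGIET R B),
    is_restriction T J TJ /\ (forall x, J x -> transient_orbit (right_open TJ) x).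

Definition domain_of_recurrence T (J : set R) : Prop :=
  right_open_union J /\
  exists (B : finType) (TJ : gGIET R B),
    is_restriction T J TJ /\ (forall x, J x -> ~ transient_orbit (right_open TJ) x).

(* Conditions (1) and (2) on the restriction to a domain of recurrence.  They
   exclude each other, as (2) provides a non-trivially recurrent orbit. *)
Definition periodic_domain T (J : set R) : Prop :=
  exists (B : finType) (TJ : gGIET R B),
    [/\ is_restriction T J TJ,
        periodic_possibly_at_endpoint TJ &
        exists p : nat, forall x, recurrent_orbit (right_open TJ) x ->
          has_period (right_open TJ) p x].

Definition quasiminimal_domain T (J : set R) : Prop :=
  exists (B : finType) (TJ : gGIET R B),
    [/\ is_restriction T J TJ,
        (exists! Q : set R, quasiminimal (right_open TJ) Q) &
        forall x, recurrent_orbit (right_open TJ) x ->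
          nontrivially_recurrent (right_open TJ) x].

Definition tower_floor T (B : finType) (Tb : gGIET R B) (p : B * nat) : set R :=
  iter p.2 T @` topI Tb p.1.

Definition tower_representation T (J : set R) (B : finType) (Tb : gGIET R B) :
    Prop :=
  exists n : B -> nat,
    let I := [set p : B * nat | p.1 \in letters Tb /\ (p.2 < n p.1)%N] in
    [/\ Itop Tb `<=` Itop T /\ Ibot Tb `<=` Ibot T,
        (forall b, b \in letters Tb -> (0 < n b)%N),
        (forall p, I p -> tower_floor T Tb p `<=` Itop T /\
           exists c d : R, c < d /\ tower_floor T Tb p = `[c, d[%classic),
        trivIset I (tower_floor T Tb) /\
        J = \bigcup_(p in I) tower_floor T Tb p &
        (forall b x, b \in letters Tb -> topI Tb b x -> Tb x = iter (n b) T x)].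

End Restriction.

(* Outcome of one step of Rauzy-Veech induction. *)
Inductive rv_case :=
| TopWins | BotWins | Tie
| TopWinsGap | BotWinsGap | TopGapWins | BotGapWins.

Section RauzyVeech.
Variables (R : realType) (A : finType).
Implicit Types T : gGIET R A.

Definition pi_top T (a : A) : nat := #|[pred b in letters T | tl T b <= tl T a]|.
Definition pi_bot T (a : A) : nat := #|[pred b in letters T | bl T b <= bl T a]|.

Definition last_top T : option A := [pick a in letters T | pi_top T a == #|letters T|].
Definition last_bot T : option A := [pick a in letters T | pi_bot T a == #|letters T|].

Definition rv_outcome (lt rt lb rb : R) : rv_case :=
  if rt == rb then
    if lt < lb then TopWins else if lb < lt then BotWins else Tie
  else if Num.max lt lb < Num.min rt rb then
    if rb < rt then TopWinsGap else BotWinsGap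
  else if rt < rb then TopGapWins else BotGapWins.

Definition branch_inv T (a : A) (y : R) : R :=
  xget 0 [set x | topI T a x /\ T x = y].

Definition remove_letter T (a : A) : gGIET R A :=
  GGIET (letters T :\ a)%SET (tl T) (tr T) (bl T) (br T) T.

Definition square_on (f : R -> R) (J : set R) : R -> R :=
  fun x => if x \in J then f (f x) else f x.

(* Only the intervals labelled by at = last_top and ab = last_bot change. *)
Definition rv_step T : gGIET R A :=
  match last_top T, last_bot T with
  | Some at_, Some ab =>
    let lt := tl T at_ in let rt := tr T at_ in
    let lb := bl T ab in let rb := br T ab in
    match rv_outcome lt rt lb rb with
    | TopWins =>
      if at_ == ab then remove_letter T at_ else
      GGIET (letters T)
        (tl T)
        [eta tr T with at_ |-> lb]
        [eta bl T with ab |-> T lb]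
        [eta br T with at_ |-> T lb, ab |-> br T at_]
        (square_on T (topI T ab))
    | BotWins =>
      if at_ == ab then remove_letter T at_ else
      let c := branch_inv T ab lt in
      GGIET (letters T)
        [eta tl T with at_ |-> c]
        [eta tr T with at_ |-> tr T ab, ab |-> c]
        (bl T)
        [eta br T with ab |-> lt]
        (square_on T `[c, tr T ab[%classic)
    | Tie =>
      if at_ == ab then remove_letter T at_ else
      GGIET (letters T :\ at_)%SET
        (tl T)
        (tr T)
        [eta bl T with ab |-> bl T at_]
        [eta br T with ab |-> br T at_]
        (square_on T (topI T ab))
    | TopWinsGap =>
      GGIET (letters T)
        (tl T)
        [eta tr T with at_ |-> rb]
        (bl T)
        [eta br T with at_ |-> T rb]
        T
    | BotWinsGap =>
      GGIET (letters T)
        (tl T)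
        [eta tr T with ab |-> branch_inv T ab rt]
        (bl T)
        [eta br T with ab |-> rt]
        T
    | TopGapWins => remove_letter T ab
    | BotGapWins => remove_letter T at_
    end
  | _, _ => T
  end.

Definition rv_iter T (n : nat) : gGIET R A := iter n rv_step T.

(* The roles (winning letter, losing letter, win against a gap) in one step,
   together with the letters that play in a tie. *)
Definition rv_winner T : option A :=
  match last_top T, last_bot T with
  | Some at_, Some ab =>
    match rv_outcome (tl T at_) (tr T at_) (bl T ab) (br T ab) with
    | TopWins | TopWinsGap => Some at_
    | BotWins | BotWinsGap => Some ab
    | Tie | TopGapWins | BotGapWins => None
    end
  | _, _ => None
  end.

Definition rv_loser T : option A :=
  match last_top T, last_bot T with
  | Some at_, Some ab =>
    match rv_outcome (tl T at_) (tr T at_) (bl T ab) (br T ab) with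
    | TopWins | TopGapWins => Some ab
    | BotWins | BotGapWins => Some at_
    | Tie | TopWinsGap | BotWinsGap => None
    end
  | _, _ => None
  end.

Definition rv_gap T : bool :=
  match last_top T, last_bot T with
  | Some at_, Some ab => tr T at_ != br T ab
  | _, _ => false
  end.

Definition rv_tied T (a : A) : bool :=
  match last_top T, last_bot T with
  | Some at_, Some ab =>
    match rv_outcome (tl T at_) (tr T at_) (bl T ab) (br T ab) with
    | Tie => (a == at_) || (a == ab)
    | _ => false
    end
  | _, _ => false
  end.

Definition wins_at T (a : A) (n : nat) : bool := rv_winner (rv_iter T n) == Some a.
Definition loses_at T (a : A) (n : nat) : bool := rv_loser (rv_iter T n) == Some a.
Definition plays_at T (a : A) (n : nat) : bool :=
  [|| wins_at T a n, loses_at T a n | rv_tied (rv_iter T n) a].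

Definition infinitely_often (P : nat -> bool) : Prop :=
  forall n, exists2 m, (n <= m)%N & P m.

Definition infinitely_renormalizable T : Prop :=
  forall n, letters (rv_iter T n) != finset.set0.

Definition RV_stable T : Prop :=
  infinitely_renormalizable T /\
  forall a, a \in letters T ->
    (forall n, ~~ plays_at T a n) \/
    infinitely_often (plays_at T a) /\
    [\/ (forall n, plays_at T a n -> wins_at T a n && ~~ loses_at T a n),
        (forall n, plays_at T a n -> loses_at T a n && ~~ wins_at T a n) |
        infinitely_often (wins_at T a) /\ infinitely_often (loses_at T a)].

(* The combinatorial rotation number of an RV-stable T is (pi, gamma) with
   pi = (pi_top T, pi_bot T) and gamma = rv_gamma T.  For RV-stable T the
   values of rv_gamma are never None, since a step without a winning letter
   removes a letter that plays. *)
Definition rv_gamma T (n : nat) : option A := rv_winner (rv_iter T n).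

Definition infinite_complete T : Prop :=
  RV_stable T /\
  forall a, a \in letters T -> infinitely_often (fun n => rv_gamma T n == Some a).

(* First n letters of gamma, without the wins against gaps. *)
Definition reduced_gamma T (n : nat) : seq A :=
  pmap (rv_gamma T) [seq m <- iota 0 n | ~~ rv_gap (rv_iter T m)].

(* a is the j-th letter of gamma once the wins against gaps are deleted. *)
Definition reduced_letter T (j : nat) (a : A) : Prop :=
  exists n, onth (reduced_gamma T n) j = Some a.

Definition same_rotation_number (T T0 : gGIET R A) : Prop :=
  [/\ RV_stable T /\ RV_stable T0,
      letters T = letters T0,
      (forall a, a \in letters T ->
         pi_top T a = pi_top T0 a /\ pi_bot T a = pi_bot T0 a) &
      (forall j a, reduced_letter T j a <-> reduced_letter T0 j a)].

End RauzyVeech.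

Definition semi_conjugated (R : realType) (A A0 : finType)
    (T : gGIET R A) (T0 : gGIET R A0) : Prop :=
  exists h : R -> R,
    [/\ {within Itop T, continuous h},
        (forall x y, Itop T x -> Itop T y -> x <= y -> h x <= h y) \/
        (forall x y, Itop T x -> Itop T y -> x <= y -> h y <= h x),
        h @` Itop T = Itop T0 &
        (forall x, Itop T x -> Itop T (T x) -> T0 (h x) = h (T x))].

Section Decomposition.
Variables (R : realType) (r : \bar R) (A : finType) (T : gGIET R A).

Definition periodic_base (B : finType) (Tb : gGIET R B) : Prop :=
  [/\ #|letters Tb| = 1%N, is_gGIET r Tb, fixed_possibly_at_endpoint Tb &
      forall x, recurrent_orbit (right_open Tb) x -> fixed_point (right_open Tb) x].

Definition quasiminimal_base (B : finType) (Tb : gGIET R B) : Prop :=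
  [/\ (1 < #|letters Tb|)%N, is_gGIET r Tb, infinite_complete Tb &
      exists T0 : gGIET R B,
        [/\ is_IET r T0, minimal T0, same_rotation_number Tb T0 &
            semi_conjugated Tb T0]].

(* The domains Rd i with i < q are the quasiminimal ones. *)
Record dynamical_decomposition (k q : nat) (D : set R) (Rd : 'I_k -> set R)
    (B : 'I_k -> finType) (Tb : forall i, gGIET R (B i)) : Prop := {
  dd_le : (q <= k)%N;
  dd_cover : `[0, 1[%classic = D `|` \bigcup_i Rd i;
  dd_disjD : forall i, D `&` Rd i = set0;
  dd_disjR : trivIset setT Rd;
  dd_transition : domain_of_transition T D;
  dd_recurrence : forall i, domain_of_recurrence T (Rd i);
  dd_tower : forall i, tower_representation T (Rd i) (Tb i);
  dd_quasiminimal : forall i : 'I_k, (i < q)%N ->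
    quasiminimal_domain T (Rd i) /\ quasiminimal_base (Tb i);
  dd_periodic : forall i : 'I_k, (q <= i)%N ->
    periodic_domain T (Rd i) /\ periodic_base (Tb i)
}.

End Decomposition.

Section InvariantMeasures.
Variables (R : realType) (A : finType).

(* Borel probability measures on [0, 1[ are encoded as Borel probability
   measures on R concentrated on [0, 1[. *)
Definition is_nonatomic_ergodic_invariant (T : gGIET R A)
    (mu : probability (measurableTypeR R) R) : Prop :=
  [/\ mu `[0, 1[%classic = 1%E,
      (forall x, mu [set x] = 0%E),
      (forall E : set (measurableTypeR R), measurable E -> E `<=` `[0, 1[%classic ->
         mu (`[0, 1[%classic `&` T @^-1` E) = mu E) &
      (forall E : set (measurableTypeR R), measurable E -> E `<=` `[0, 1[%classic ->
         `[0, 1[%classic `&` T @^-1` E = E -> mu E = 0%E \/ mu E = 1%E)].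

(* A library measure is a function on all sets, with unconstrained values on
   non-measurable ones.  These values are discarded (replaced by 0), so that
   two measures are identified exactly when they agree on Borel sets. *)
Definition nonatomic_ergodic_measures (T : gGIET R A) :
    set (set (measurableTypeR R) -> \bar R) :=
  [set m | exists2 mu : probability (measurableTypeR R) R,
     is_nonatomic_ergodic_invariant T mu &
     m = patch (fun=> 0%E) measurable mu].

End InvariantMeasures.

(* Main.v *)
(** Every x in R_i stays in R_i forever, forward or backward, so R_i is
    invariant up to a null set of any invariant measure, while every point of
    D leaves D; hence a non-atomic ergodic measure mu lives on exactly one
    R_i, and it restricts to an ergodic measure nu on the base of its tower.
    Let nu_1, ..., nu_m be obtained in this way from distinct measures on R_i,
    let lambda_j be the vector of the nu_j-measures of the d top intervals and
    G_j(x) = nu_j(]-oo, x]).  On each top interval G_j(T_i x) - G_j(x) is a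
    constant, which gives a vector delta_j depending linearly on lambda_j.
    - The nu_j being T_i-invariant, lambda_l . delta_j is the nu_l-integral of
      G_j o T_i - G_j, which is 0.
    - The delta_j are linearly independent: if sum_j c_j delta_j = 0, then
      G = sum_j c_j G_j is T_i-invariant, hence almost everywhere constant for
      each nu_l; being continuous, G is then 0, and c = 0 since distinct
      ergodic measures are mutually singular.
    So the lambda_j and the delta_j span two orthogonal subspaces of dimension
    m in R^d, whence 2m <= d.  In particular no such measure lives on a
    periodic domain, where d = 1. *)

Require Import Defs.
From HB Require Import structures.
From mathcomp Require Import all_boot all_order all_algebra.
From mathcomp Require Import all_classical all_reals all_analysis.
From mathcomp Require Import measurable_realfun lra.
Set Implicit Arguments.
Unset Strict Implicit.
Unset Printing Implicit Defensive.
Import Order.TTheory GRing.Theory Num.Theory.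
Import numFieldNormedType.Exports.
Local Open Scope classical_set_scope.
Local Open Scope ring_scope.

(** * Ergodic measures of a transformation *)

Lemma cancel_iter (T : Type) (f g : T -> T) n :
  cancel f g -> cancel (iter n f) (iter n g).
Proof.
by move=> fgK; elim: n => [//|n ih] x; rewrite (iterSr n g) iterS fgK ih.
Qed.

Section ErgodicTheory.
Local Open Scope ereal_scope.
Context d (X : measurableType d) (R : realType).
Implicit Types (mu : {finite_measure set X -> \bar R}) (E : set X).

Definition invariant_measure (f : X -> X) (mu : set X -> \bar R) :=
  forall E, measurable E -> mu (f @^-1` E) = mu E.

(** Asking for a null complement instead of full mass makes the notion fit finite measures that are
    not normalized. *)
Definition ergodic (f : X -> X) (mu : set X -> \bar R) :=
  forall E, measurable E -> f @^-1` E = E -> mu E = 0 \/ mu (~` E) = 0.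

Lemma measurable_preimage (f : X -> X) E :
  measurable_fun setT f -> measurable E -> measurable (f @^-1` E).
Proof. by move=> mf mE; rewrite -[X in measurable X]setTI; exact: mf. Qed.

Lemma measurable_preimage_iter (f : X -> X) n E :
  measurable_fun setT f -> measurable E -> measurable (iter n f @^-1` E).
Proof.
move=> mf mE; elim: n => [//|n ih].
by rewrite [X in measurable X](_ : _ = f @^-1` (iter n f @^-1` E));
  [exact: measurable_preimage|apply/seteqP; split => x /=; rewrite -iterS iterSr].
Qed.

Lemma invariant_measure_iter (f : X -> X) (mu : set X -> \bar R) n :
  measurable_fun setT f -> invariant_measure f mu ->
  invariant_measure (iter n f) mu.
Proof.
move=> mf imu; elim: n => [//|n ih] E mE.
rewrite [X in mu X](_ : _ = iter n f @^-1` (f @^-1` E)); last first.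
  by apply/seteqP; split => x.
by rewrite ih ?imu//; exact: measurable_preimage.
Qed.

Lemma finite_measureD mu A B : measurable A -> measurable B ->
  mu (A `\` B) = mu A - mu (A `&` B).
Proof.
by move=> mA mB; apply: (@measureD _ _ _ mu) => //; rewrite ltey_eq fin_num_measure.
Qed.

Lemma measure0_subsetU mu A B C : measurable A -> measurable B ->
  measurable C -> A `<=` B `|` C -> mu B = 0 -> mu C = 0 -> mu A = 0.
Proof.
move=> mA mB mC ABC B0 C0; apply: (subset_measure0 mA (measurableU _ _ mB mC) ABC).
by apply/null_set_setU.
Qed.

Lemma eq_measure_setD0 mu A B : measurable A -> measurable B ->
  mu A = mu B -> mu (A `\` B) = 0 -> mu (B `\` A) = 0.
Proof. by move=> mA mB AB; rewrite !finite_measureD// AB setIC. Qed.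

(** The set [L] of points visiting [E] infinitely often is strictly invariant and differs from [E]
    by a null set, so ergodicity applies to [L]. *)
Lemma ergodic_ae (f : X -> X) mu E : measurable_fun setT f ->
  invariant_measure f mu -> ergodic f mu -> measurable E ->
  mu (f @^-1` E `\` E) = 0 -> mu E = 0 \/ mu (~` E) = 0.
Proof.
move=> mf imu emu mE fE.
have mfn n : measurable (iter n f @^-1` E) by exact: measurable_preimage_iter.
have fnE n : mu (iter n f @^-1` E `\` E) = 0.
  elim: n => [|n ih].
    by rewrite (_ : _ `\` _ = set0) ?measure0//; apply/seteqP; split => // x [].
  have mD : measurable (f @^-1` E `\` E).
    by apply: measurableD => //; exact: measurable_preimage.
  apply: (@measure0_subsetU _ _ (iter n f @^-1` (f @^-1` E `\` E))
     (iter n f @^-1` E `\` E)) => //.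
  - by apply: measurableD => //; exact: (mfn n.+1).
  - exact: measurable_preimage_iter.
  - exact: measurableD.
  - move=> x [/= fx Ex]; have [h|h] := pselect (E (iter n f x)).
      by right.
    by left.
  - by rewrite invariant_measure_iter.
have Efn n : mu (E `\` iter n f @^-1` E) = 0.
  by apply: eq_measure_setD0 => //; rewrite invariant_measure_iter.
pose L := \bigcap_N \bigcup_n (iter (N + n) f @^-1` E).
have mU N : measurable (\bigcup_n (iter (N + n) f @^-1` E)).
  by apply: bigcup_measurable => n _.
have mL : measurable L by apply: bigcapT_measurable.
have fL : f @^-1` L = L.
  apply/seteqP; split => x /= Lx N _.
    have [n _ /=] := Lx N I; rewrite -iterSr => h.
    by exists n.+1; rewrite //= addnS.
  by have [n _ h] := Lx N.+1 I; exists n => //=; rewrite -iterSr.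
have LE : mu (L `\` E) = 0.
  apply/negligibleP; first exact: measurableD.
  apply: (@negligibleS _ _ _ mu (\bigcup_n (iter n f @^-1` E `\` E))).
    by move=> x [/(_ 0%N I)[n _ h] Ex]; exists n.
  by apply: negligible_bigcup => n; apply/negligibleP; [exact: measurableD|exact: fnE].
have EL : mu (E `\` L) = 0.
  apply/negligibleP; first exact: measurableD.
  apply: (@negligibleS _ _ _ mu (\bigcup_n (E `\` iter n f @^-1` E))).
    move=> x [Ex /= Lx]; apply: contra_notP Lx => h N _; exists 0%N => //=.
    by rewrite addn0; apply: contrapT => h'; apply: h; exists N.
  by apply: negligible_bigcup => n; apply/negligibleP; [exact: measurableD|exact: Efn].
have [L0|L0] := emu _ mL fL; [left|right].
  apply: (@measure0_subsetU _ _ L (E `\` L)) => //.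
    exact: measurableD.
  by move=> x Ex; have [|] := pselect (L x); [left|right].
apply: (@measure0_subsetU _ _ (~` L) (L `\` E)) => //.
- exact: measurableC.
- exact: measurableC.
- exact: measurableD.
- by move=> x Ex; have [|] := pselect (L x); [right|left].
Qed.

End ErgodicTheory.

(* The union of all preimages of a Hahn negative set of mu1 - mu2 is still
   negative, contains its preimage, and so has measure 0 or 1 for both. *)

Lemma ergodic_mutually_singular d (X : measurableType d) (R : realType)
    (f g : X -> X) (mu1 mu2 : probability X R) (E : set X) :
  measurable_fun setT f -> measurable_fun setT g -> cancel f g -> cancel g f ->
  invariant_measure f mu1 -> invariant_measure f mu2 ->
  ergodic f mu1 -> ergodic f mu2 ->
  measurable E -> mu1 E != mu2 E ->
  exists S, [/\ measurable S, mu1 (~` S) = 0%E & mu2 S = 0%E].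
Proof.
move=> mf mg fgK gfK i1 i2 e1 e2.
(* Both masses being 1, passing to the complement of [E] reverses the inequality. *)
wlog : E / (mu2 E < mu1 E)%E => [wh mE neq|].
  move: (neq); rewrite neq_lt => /orP[lt12|]; last by move/wh; exact.
  have mEC : measurable (~` E) by exact: measurableC.
  have ltC : (mu2 (~` E) < mu1 (~` E))%E.
    rewrite !probability_setC//.
    move: lt12; rewrite -(fineK (fin_num_measure mu1 _ mE)).
    rewrite -(fineK (fin_num_measure mu2 _ mE)) -!EFinB !lte_fin.
    by rewrite ltrD2l ltrN2.
  by apply: (wh (~` E) ltC mEC); rewrite gt_eqF.
move=> lt21 mE _.
pose c1 := charge_of_finite_measure mu1.
pose c2 := charge_of_finite_measure mu2.
pose nu : {charge set X -> \bar R} := cadd c1 (copp c2).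
have [P [N [[mP posP] [mN negN] PN PN0]]] := Hahn_decomposition nu.
have nuE A : measurable A -> nu A = (fine (mu1 A) - fine (mu2 A))%:E.
  by move=> mA; rewrite EFinB !fineK ?fin_num_measure.
(* Invertibility enters here: a measurable subset of the preimage is itself the n-th preimage of a
   measurable subset of [N] with the same [nu]-value. *)
have negNn n : negative_set nu (iter n f @^-1` N).
  split => [|A mA AN]; first exact: measurable_preimage_iter.
  have AE : A = iter n f @^-1` (iter n g @^-1` A).
    by apply/seteqP; split => x /=; rewrite (cancel_iter n fgK).
  have mgA : measurable (iter n g @^-1` A) by exact: measurable_preimage_iter.
  rewrite nuE// AE !(invariant_measure_iter n mf)// -nuE//.
  by apply: negN => // x /= /AN /=; rewrite (cancel_iter n gfK).
pose M := \bigcup_n (iter n f @^-1` N).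
have [mM negM] : negative_set nu M by exact: bigcup_negative_set.
have fM : f @^-1` M `\` M = set0.
  apply/seteqP; split => // x [[n _ /=]]; rewrite -iterSr => fn [].
  by exists n.+1.
have mCM : measurable (~` M) by exact: measurableC.
(* Going from [E] to the complement of [M] removes a part of the negative set [M] and adds a part of
   the positive set [P], so the excess of [mu1] over [mu2] does not decrease. *)
have nuM : (fine (mu2 (~` M)) < fine (mu1 (~` M)))%R.
  have EM : (nu (E `&` M) <= 0)%E by apply: negM; [exact: measurableI|move=> x []].
  have PEM : (0 <= nu (~` M `\` E))%E.
    apply: posP; first exact: measurableD.
    move=> x [Mx _]; have : setT x by []; rewrite -PN => -[//|Nx].
    by exfalso; apply: Mx; exists 0%N.
  have split1 (mu : probability X R) :
      fine (mu (~` M)) = (fine (mu (~` M `\` E)) + fine (mu E) - fine (mu (E `&` M)))%R.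
    apply: EFin_inj; rewrite EFinB EFinD !fineK ?fin_num_measure//;
      try by [exact: measurableI|exact: measurableD].
    rewrite (measureDI mu mCM mE) -addeA; congr (_ + _)%E.
    rewrite [X in _ = (X - _)%E](measureDI mu mE mM) addeK//; last first.
      by apply: fin_num_measure; exact: measurableI.
    by congr (mu _); rewrite setDE setIC.
  move: EM PEM; rewrite !nuE; [|exact: measurableD|exact: measurableI].
  rewrite !lee_fin (split1 mu1) (split1 mu2) => h1 h2.
  move: lt21; rewrite -(fineK (fin_num_measure mu1 _ mE)).
  rewrite -(fineK (fin_num_measure mu2 _ mE)) !lte_fin => h3.
  lra.
exists (~` M); split => //.
- rewrite setCK; have [//|h] := ergodic_ae mf i1 e1 mM (etrans (f_equal mu1 fM) (measure0 mu1)).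
  by move: nuM; rewrite h/= ltNge fine_ge0.
- have [h|//] := ergodic_ae mf i2 e2 mM (etrans (f_equal mu2 fM) (measure0 mu2)).
  move: nuM; rewrite probability_setC// h sube0/= ltNge -lee_fin fineK ?fin_num_measure//.
  by rewrite probability_le1.
Qed.

(** * Finite measures *)

Section FiniteMeasure.
Context d (X : measurableType d) (R : realType).
Variable mu : {finite_measure set X -> \bar R}.

Lemma fineK_measure E : measurable E -> (fine (mu E))%:E = mu E.
Proof. by move=> mE; rewrite fineK ?fin_num_measure. Qed.

Lemma fine_measure_eq0 E : measurable E -> fine (mu E) = 0 -> mu E = 0%E.
Proof. by move=> mE h; rewrite -fineK_measure// h. Qed.

Lemma fine_measureU A C : measurable A -> measurable C -> A `&` C = set0 ->
  fine (mu (A `|` C)) = fine (mu A) + fine (mu C).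
Proof.
move=> mA mC AC; apply: EFin_inj; rewrite EFinD !fineK_measure//; last exact: measurableU.
by rewrite measureU.
Qed.

Lemma fine_measureDI A C : measurable A -> measurable C ->
  fine (mu A) = fine (mu (A `\` C)) + fine (mu (A `&` C)).
Proof.
move=> mA mC; have mD := measurableD mA mC; have mI := measurableI _ _ mA mC.
by apply: EFin_inj; rewrite EFinD !fineK_measure// (measureDI mu mA mC).
Qed.

Lemma fine_measure_sum (I : finType) (s : {set I}) (F : I -> set X) :
  (forall i, measurable (F i)) -> trivIset [set` s] F ->
  fine (mu (\bigcup_(i in [set` s]) F i)) = \sum_(i in s) fine (mu (F i)).
Proof.
move=> mF tF; apply: EFin_inj; rewrite fineK_measure; last first.
  exact: fin_bigcup_measurable.
rewrite measure_fin_bigcup//.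
rewrite -sumEFin -big_enum (_ : [set` s] = [set` enum s]); last first.
  by apply/seteqP; split => i /=; rewrite mem_enum.
rewrite -fsbig_seq ?enum_uniq//.
by rewrite big_enum/= big_enum; apply: eq_bigr => i _; rewrite fineK_measure.
Qed.

Lemma fine_measure_cvg (F : (set X)^nat) : (forall i, measurable (F i)) ->
  trivIset setT F ->
  (fun n => \sum_(0 <= i < n) fine (mu (F i))) @ \oo --> fine (mu (\bigcup_n F n)).
Proof.
move=> mF tF; have mU : measurable (\bigcup_n F n) by exact: bigcup_measurable.
have h := @measure_semi_sigma_additive _ _ _ mu F mF tF mU.
have h2 : (fun n => (\sum_(0 <= i < n) fine (mu (F i)))%:E) @ \oo -->
    (fine (mu (\bigcup_n F n)))%:E.
  rewrite fineK_measure//; apply: cvg_trans h; apply: near_eq_cvg.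
  by near=> n; rewrite -sumEFin; apply: eq_bigr => i _; rewrite fineK_measure.
by move/fine_cvgP : h2 => [].
Unshelve. all: by end_near. Qed.

Lemma null_subset A C : measurable A -> measurable C -> A `<=` C ->
  mu C = 0%E -> mu A = 0%E.
Proof. by move=> mA mC sAC; exact: (subset_measure0 mA mC sAC). Qed.

End FiniteMeasure.

(* A bounded invariant function g is almost everywhere equal to
   sup {v | g > v almost everywhere}. *)
Lemma ergodic_ae_constant d (X : measurableType d) (R : realType)
    (mu : {finite_measure set X -> \bar R}) (f : X -> X) (g : X -> R) (K : R) :
  ergodic f mu -> measurable_fun [set: X] g -> (forall x, `|g x| <= K) ->
  (forall x, g (f x) = g x) ->
  exists c, mu [set x | g x != c] = 0%E.
Proof.
move=> emu mg gK gf.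
have mle v : measurable [set x | g x <= v].
  rewrite [X in measurable X](_ : _ = setT `&` g @^-1` `]-oo, v]).
    by apply: mg => //; exact: measurable_itv.
  by rewrite setTI; apply/seteqP; split => x; rewrite /= in_itv.
have mneq c : measurable [set x | g x != c].
  rewrite [X in measurable X](_ : _ = setT `&` g @^-1` (~` [set c])).
    by apply: mg => //; exact: measurableC.
  by rewrite setTI; apply/seteqP; split => x /=; move/eqP.
have inv v : f @^-1` [set x | g x <= v] = [set x | g x <= v].
  by apply/seteqP; split => x /=; rewrite gf.
have erg v := emu _ (mle v) (inv v).
pose S := [set v | mu [set x | g x <= v] = 0%E].
(* For [mu = 0] the set [S] is the whole line and has no supremum; any constant will do. *)
have [muT|muT] := eqVneq (mu setT) 0%E.
  by exists 0; apply: (null_subset _ _ _ muT).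
have Sub : has_sup S.
  split.
    exists (- K - 1); rewrite /S/= (_ : [set x | _] = set0) ?measure0//.
    apply/seteqP; split => // x /=; have := gK x; rewrite ler_norml => /andP[h _] h'.
    by have := le_trans h h'; rewrite lerBrDl gerDr ler10.
  exists K => v Sv; rewrite leNgt; apply/negP => Kv; move/eqP: muT; apply.
  rewrite -Sv; congr (mu _); apply/seteqP; split => // x _ /=.
  by rewrite (le_trans _ (ltW Kv))// (le_trans (ler_norm _)).
pose c := sup S; exists c.
have null_lt n : mu [set x | g x <= c - n.+1%:R^-1] = 0%E.
  have n0 : 0 < n.+1%:R^-1 :> R by rewrite invr_gt0 ltr0Sn.
  have [v Sv cv] := sup_adherent n0 Sub.
  by apply: null_subset Sv => // x /= /le_trans; apply; exact: ltW.
(* A level above the supremum is not in [S]: its sublevel set is not null, so ergodicity makes the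
   complement null. *)
have null_gt n : mu (~` [set x | g x <= c + n.+1%:R^-1]) = 0%E.
  have [h|//] := erg (c + n.+1%:R^-1).
  have : c + n.+1%:R^-1 <= c by apply: ub_le_sup => //; exact: (proj2 Sub).
  by rewrite gerDl leNgt invr_gt0 ltr0Sn.
have gap (x y : R) : x < y -> exists n : nat, x < y - n.+1%:R^-1.
  move=> xy; have yx : 0 < y - x by rewrite subr_gt0.
  have [n _ /(_ n (leqnn n))] := near_infty_natSinv_lt (PosNum yx).
  by move=> /= h; exists n; rewrite ltrBrDr -ltrBrDl.
apply/negligibleP => //.
apply: (@negligibleS _ _ _ mu ((\bigcup_n [set x | g x <= c - n.+1%:R^-1]) `|`
    \bigcup_n (~` [set x | g x <= c + n.+1%:R^-1]))).
  move=> x /=; rewrite neq_lt => /orP[/gap[n gn]|/gap[n gn]].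
    by left; exists n => //=; exact: ltW.
  by right; exists n => //=; apply/negP; rewrite -ltNge -ltrBrDr.
apply: negligibleU; apply: negligible_bigcup => n.
  by apply/negligibleP; [exact: mle|exact: null_lt].
by apply/negligibleP; [exact/measurableC/mle|exact: null_gt].
Qed.

(** * Distribution functions *)

Lemma cvg_linear_combination (R : realType) (I : finType) (T : Type)
    (F : set_system T) (FF : Filter F) (c : I -> R) (f : I -> T -> R) (a : I -> R) :
  (forall i, f i x @[x --> F] --> a i) ->
  \sum_i c i * f i x @[x --> F] --> \sum_i c i * a i.
Proof.
move=> fa; apply: (@cvg_big _ _ +%R 0 xpredT (@add_continuous R)) => // i _.
by apply: cvgM => //; exact: cvg_cst.
Qed.

Section Cumul.
Context (R : realType).
Let X := measurableTypeR R.
Implicit Types mu : {finite_measure set X -> \bar R}.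

Definition cumul (mu : set X -> \bar R) (x : R) : R := fine (mu `]-oo, x]%classic).

Lemma cumulB mu x y : x <= y -> cumul mu y - cumul mu x = fine (mu `]x, y]%classic).
Proof.
move=> xy; apply/eqP; rewrite subr_eq addrC; apply/eqP.
rewrite /cumul -fine_measureU; [|exact: measurable_itv..|]; last first.
  apply/seteqP; split => // z /= []; rewrite !in_itv /= => zx /andP[xz _].
  by move: (lt_le_trans xz zx); rewrite ltxx.
congr (fine (mu _)); apply/seteqP; split => z /=; rewrite !in_itv /=.
  by move=> zy; have [zx|xz] := leP z x; [left|right; apply/andP].
by move=> [zx|/andP[]//]; exact: le_trans xy.
Qed.

Lemma fine_measure_le mu A E : measurable A -> measurable E -> A `<=` E ->
  fine (mu A) <= fine (mu E).
Proof.
move=> mA mE AE; apply: fine_le; rewrite ?fin_num_measure//.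
by apply: le_measure; rewrite ?inE.
Qed.

Lemma cumul_bounded mu x : `|cumul mu x| <= fine (mu setT).
Proof.
by rewrite ger0_norm ?fine_ge0//; apply: fine_measure_le.
Qed.

Lemma cumul_nondecreasing mu x y : x <= y -> cumul mu x <= cumul mu y.
Proof. by move=> xy; rewrite -subr_ge0 cumulB// fine_ge0. Qed.

(** Half-open windows shrinking to [x] have measure tending to that of the point, namely 0, and they
    bound the increments of [cumul] near [x]. *)
Lemma continuous_cumul mu : (forall x, mu [set x] = 0%E) -> continuous (cumul mu).
Proof.
move=> mu1 x; pose F n : set X := `]x - n.+1%:R^-1, x + n.+1%:R^-1]%classic.
have mF n : measurable (F n) by exact: measurable_itv.
have capF : \bigcap_n F n = [set x].
  apply/seteqP; split => [y Fy|_ -> n _]; last first.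
    by rewrite /F /= in_itv /= gtrDl oppr_lt0 lerDl invr_gt0 invr_ge0 ltr0Sn ler0n.
  apply/eqP; rewrite eq_sym -subr_eq0 -normr_eq0; apply/contraT => xy.
  have xy0 : 0 < `|x - y| by rewrite lt_neqAle eq_sym xy normr_ge0.
  have [n _ /(_ n (leqnn n)) /= h] := near_infty_natSinv_lt (PosNum xy0).
  have := Fy n I; rewrite /F /= in_itv /= => /andP[h1 h2].
  suff : `|x - y| <= n.+1%:R^-1 by rewrite leNgt h.
  rewrite ler_norml; move: h1 h2; move: (n.+1%:R^-1) => e h1 h2.
  by apply/andP; split; lra.
have cvgF : (fun n => fine (mu (F n))) @ \oo --> (0 : R).
  have h : mu \o F @ \oo --> 0%E.
    rewrite -(mu1 x) -capF; apply: nonincreasing_cvg_mu => //.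
    - by rewrite ltey_eq fin_num_measure.
    - exact: bigcapT_measurable.
    - move=> n m nm; apply/subsetPset => y; rewrite /F /= !in_itv /=.
      have : m.+1%:R^-1 <= n.+1%:R^-1 :> R by rewrite lef_pV2 ?posrE// ler_nat.
      move: (m.+1%:R^-1) (n.+1%:R^-1) => e e'.
      by move=> h /andP[h1 h2]; apply/andP; split; lra.
  have h2 : (fun n => (fine (mu (F n)))%:E) @ \oo --> (0 : R)%:E.
    apply: cvg_trans h; apply: near_eq_cvg; near=> n.
    by rewrite /= fineK_measure.
  by move/fine_cvgP : h2 => [].
apply/cvgrPdist_lt => e e0.
move/cvgrPdist_lt : cvgF => /(_ e e0)[n _ /(_ n (leqnn n))/=].
rewrite sub0r normrN ger0_norm ?fine_ge0// => Fe.
exists n.+1%:R^-1 => /=; first by rewrite invr_gt0 ltr0Sn.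
move=> y /=; rewrite ltr_norml => /andP[h1 h2].
apply: le_lt_trans Fe; move: h1 h2 (mF n); rewrite /F; move: (n.+1%:R^-1) => d h1 h2 mFn.
have [xy|yx] := leP x y.
  rewrite distrC ger0_norm ?subr_ge0 ?cumul_nondecreasing// cumulB//.
  apply: fine_measure_le => //.
  by move=> z; rewrite /= !in_itv /= => /andP[h3 h4]; apply/andP; split; lra.
rewrite ger0_norm ?subr_ge0 ?cumul_nondecreasing// ?(ltW yx)// cumulB ?(ltW yx)//.
apply: fine_measure_le => //.
by move=> z; rewrite /= !in_itv /= => /andP[h3 h4]; apply/andP; split; lra.
Unshelve. all: by end_near. Qed.

Section Combination.
Variables (m : nat) (nu : 'I_m -> {finite_measure set X -> \bar R}) (c : 'I_m -> R).

(** The distribution function of the signed measure with coefficients [c]; the signed measure itself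
    is never formed. *)
Definition ccumul (x : R) : R := \sum_i c i * cumul (nu i) x.

Hypothesis nu1 : forall i x, nu i [set x] = 0%E.

Lemma continuous_ccumul : continuous ccumul.
Proof.
by move=> x; apply: cvg_linear_combination => i; exact: continuous_cumul.
Qed.

Lemma ccumulB x y : x <= y ->
  ccumul y - ccumul x = \sum_i c i * fine (nu i `]x, y]%classic).
Proof.
move=> xy; rewrite /ccumul -sumrB; apply: eq_bigr => i _.
by rewrite -mulrBr cumulB.
Qed.

(* Otherwise let a be the last point before y where ccumul is at most v, for a
   value v such that no k i lies in ]v, ccumul y[: just after a the measures
   nu i vanish, so that ccumul is constant there. *)
Lemma ccumul_le0 (k : 'I_m -> R) (x0 : R) : (forall x, x <= x0 -> ccumul x = 0) ->
  (forall i, nu i [set x | ccumul x != k i] = 0%E) -> forall y, ccumul y <= 0.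
Proof.
move=> G0 Gk y; rewrite leNgt; apply/negP => y0.
(* The default value 0 gives [0 <= v], which puts [x0] in [S]. *)
pose v := \big[Num.max/0]_(i | k i < ccumul y) k i.
have v0 : 0 <= v by exact: bigmax_ge_id.
have vy : v < ccumul y by apply/bigmax_ltP; split.
have kv i : k i <= v \/ ccumul y <= k i.
  by have [h|] := ltP (k i) (ccumul y); [left; exact: le_bigmax_cond|right].
pose S := [set x | x <= y /\ ccumul x <= v].
have x0y : x0 < y.
  by rewrite ltNge; apply/negP => /G0 yy; move: y0; rewrite yy ltxx.
have supS : has_sup S.
  by split; [exists x0; split; [exact: ltW|rewrite G0]|exists y => x []].
pose a := sup S.
have ay : a <= y by apply: ge_sup => [|x []]; first exact: (proj1 supS).
have Ga : ccumul a <= v.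
  rewrite leNgt; apply/negP => va.
  have /cvgrPdist_lt/(_ _ (_ : 0 < ccumul a - v)) := continuous_ccumul (x := a).
  rewrite subr_gt0 => /(_ va)[e /= e0 ae].
  have [z [zy Gz] az] := sup_adherent e0 supS.
  have za : z <= a by apply: ub_le_sup; [exact: (proj2 supS)|split].
  have : `|ccumul a - ccumul z| < ccumul a - v.
    by apply: ae; rewrite /= ger0_norm ?subr_ge0//; rewrite -/a in az; lra.
  by rewrite ltr_norml => /andP[_]; lra.
have {}ay : a < y.
  by rewrite lt_neqAle ay andbT; apply/eqP => ay'; move: vy; rewrite -ay' ltNge Ga.
have /cvgrPdist_lt/(_ _ (_ : 0 < ccumul y - ccumul a)) := continuous_ccumul (x := a).
rewrite subr_gt0 => /(_ (le_lt_trans Ga vy))[e /= e0 ae].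
pose b := Num.min y (a + e / 2).
have ab : a < b by rewrite lt_min ay ltrDl divr_gt0.
have by_ : b <= y by rewrite ge_min lexx.
have be : b <= a + e / 2 by rewrite ge_min lexx orbT.
(* Beyond [a] the value exceeds [v], since [a] is the supremum of [S]; within distance [e] of [a] it
   stays below [ccumul y]. *)
have Gab x : a < x <= b -> v < ccumul x < ccumul y.
  move=> /andP[ax xb]; apply/andP; split.
    rewrite ltNge; apply/negP => Gx; move: ax; rewrite ltNge => /negP; apply.
    by apply: ub_le_sup; [exact: (proj2 supS)|split => //; exact: le_trans by_].
  have : `|ccumul a - ccumul x| < ccumul y - ccumul a.
    by apply: ae; rewrite /= distrC ger0_norm ?subr_ge0 ?(ltW ax)//; lra.
  by rewrite ltr_norml => /andP[]; lra.
(* On []a, b]] the function avoids the value [k i], so this interval lies in a null set of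
   [nu i]. *)
have nuab i : fine (nu i `]a, b]%classic) = 0.
  suff -> : nu i `]a, b]%classic = 0%E by [].
  apply: (null_subset _ _ _ (Gk i)).
  - exact: measurable_itv.
  - have cG := continuous_measurable_fun continuous_ccumul.
    rewrite [X in measurable X](_ : _ = setT `&` ccumul @^-1` (~` [set k i])).
      by apply: cG => //; apply: measurableC; exact: measurable_set1.
    by rewrite setTI; apply/seteqP; split => x /=; move/eqP.
  - move=> x; rewrite /= in_itv /= => /Gab/andP[vx xy].
    by rewrite neq_lt; have [h|h] := kv i; apply/orP; [right|left];
      [exact: le_lt_trans vx|exact: lt_le_trans h].
have := ccumulB (ltW ab); rewrite big1 => [Gba|i _]; last by rewrite nuab mulr0.
have /andP[vb _] : v < ccumul b < ccumul y by apply: Gab; rewrite ab lexx.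
by move/subr0_eq : Gba vb Ga => ->; lra.
Qed.

(* The rays ]x, +oo[ form a pi-system generating the Borel sets. *)
Lemma ccumul_eq0 : (forall x, ccumul x = 0) ->
  \sum_i c i * fine (nu i setT) = 0 ->
  forall E, measurable E -> \sum_i c i * fine (nu i E) = 0.
Proof.
move=> G0 GT E mE.
have sgE : <<s RGenOInfty.G (R := R) >> E.
  exact: (eq_ind _ (fun P : set_system R => P E) mE _
    (RGenOInfty.measurableE R)).
move: E sgE {mE}; apply: (@dynkin_induction _ X
  (RGenOInfty.G (R := R))
  (fun E => \sum_i c i * fine (nu i E) = 0)) => //.
- exact: RGenOInfty.measurableE.
- move=> _ _ [x ->] [y ->]; exists (Num.max x y).
  by apply/seteqP; split => z; rewrite /= !in_itv /= !andbT gt_max; [move=> [-> ->]|move/andP].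
- move=> _ [x ->].
  transitivity (\sum_i c i * fine (nu i setT) - ccumul x); last by rewrite GT G0 subr0.
  rewrite /ccumul -sumrB; apply: eq_bigr => i _.
  rewrite -mulrBr; congr (_ * _).
  rewrite /cumul (@fine_measureDI _ _ _ (nu i) setT `]-oo, x]%classic)//.
  by rewrite setTI addrK setTD setCitvl.
- move=> S mS S0.
  transitivity (\sum_i c i * fine (nu i setT) - \sum_i c i * fine (nu i S));
    last by rewrite GT S0 subr0.
  rewrite -sumrB; apply: eq_bigr => i _.
  rewrite -mulrBr; congr (_ * _).
  by rewrite (@fine_measureDI _ _ _ (nu i) setT S)// setTI addrK setTD.
- move=> F mF tF F0.
  (* For a disjoint union the partial sums satisfy the relation exactly, and it passes to the
     limit. *)
  have h : (fun n => \sum_i c i * \sum_(0 <= j < n) fine (nu i (F j))) @ \oo -->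
      \sum_i c i * fine (nu i (\bigcup_n F n)).
    by apply: cvg_linear_combination => i; exact: fine_measure_cvg.
  have h0 : (fun n => \sum_i c i * \sum_(0 <= j < n) fine (nu i (F j))) = cst 0.
    apply/funext => n; under eq_bigr do rewrite mulr_sumr.
    by rewrite exchange_big big1.
  by move: h; rewrite h0 => /(cvg_lim (@Rhausdorff R)) <-; exact: lim_cst.
Qed.

End Combination.
End Cumul.

(** * Branches of a g-GIET *)

Section Branches.
Variables (R : realType) (r : \bar R).
Hypothesis r0 : (0%:E <= r)%E.

Lemma Cr_continuous (f : R -> R) : Cr r f -> continuous f.
Proof. by move=> [Cf _]; have [] := Cf 0%N r0. Qed.

(** Of the smoothness only continuity is kept. An increasing surjection between closed intervals
    matches their endpoints, so the half-open intervals correspond too. *)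
Lemma Cr_diffeo_extP (f : R -> R) (a b c d : R) : a < b ->
  Cr_diffeo_ext r f a b c d ->
  exists F G : R -> R,
    [/\ continuous F /\ continuous G,
        {in `[a, b[, f =1 F},
        {in `[a, b[ &, {mono f : x y / x <= y}},
        f @` `[a, b[ = `[c, d[%classic &
        {in `[a, b[, cancel f G}].
Proof.
move=> ab [F [G [[CF CG] fF Fmono Fim [FG GF]]]].
have Fle x y : x \in `[a, b] -> y \in `[a, b] -> (F x <= F y) = (x <= y).
  rewrite !in_itv /= => /andP[ax xb] /andP[ay yb].
  have [xy|yx|->] := ltgtP x y; last exact: lexx.
    by apply/ltW; exact: Fmono.
  by apply/negbTE; rewrite -ltNge; exact: Fmono.
have sub x : x \in `[a, b[ -> x \in `[a, b].
  by rewrite !in_itv /= => /andP[-> /ltW ->].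
have aab : a \in `[a, b] by rewrite in_itv /= lexx ltW.
have bab : b \in `[a, b] by rewrite in_itv /= lexx ltW.
have Fab x : x \in `[a, b] -> F x \in `[c, d].
  by move=> xab; have : `[c, d]%classic (F x) by rewrite -Fim; exists x.
have ex y : y \in `[c, d] -> exists2 x, x \in `[a, b] & F x = y.
  by move=> ycd; have : `[c, d]%classic y by []; rewrite -Fim => -[x ? ?]; exists x.
have Fa : F a = c.
  have := Fab _ aab; rewrite in_itv /= => /andP[cFa Fad].
  apply/eqP; rewrite eq_le cFa andbT; have [x xab <-] : exists2 x, x \in `[a, b] & F x = c.
    by apply: ex; rewrite in_itv /= lexx (le_trans cFa).
  by rewrite Fle//; move: xab; rewrite in_itv => /andP[].
have Fb : F b = d.
  have := Fab _ bab; rewrite in_itv /= => /andP[cFb Fbd].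
  apply/eqP; rewrite eq_le Fbd /=.
  have [x xab <-] : exists2 x, x \in `[a, b] & F x = d.
    by apply: ex; rewrite in_itv /= lexx andbT (le_trans cFb).
  by rewrite Fle//; move: xab; rewrite in_itv => /andP[].
have fFi : {in `[a, b[, f =1 F} by move=> x; rewrite in_itv /= => /fF.
exists F, G; split => //.
- by split; exact: Cr_continuous.
- by move=> x y xab yab; rewrite /= !fFi// Fle// sub.
- apply/seteqP; split => [y [x /= xab <-]|y /= ycd].
    have := xab; rewrite (fFi _ xab) /= !in_itv /= -Fa -Fb => /andP[ax xb].
    by have xI := sub _ xab; rewrite Fle// ax ltNge Fle// -ltNge.
  have [x xab Fx] : exists2 x, x \in `[a, b] & F x = y.
    by apply: ex; move: ycd; rewrite !in_itv /= => /andP[-> /ltW].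
  have xab' : x \in `[a, b[.
    move: ycd; rewrite !in_itv /= -Fa -Fb -Fx Fle// ltNge Fle// -ltNge.
    by [].
  by exists x => //; rewrite fFi.
- by move=> x xab; rewrite fFi// FG//; have := sub _ xab; rewrite in_itv.
Qed.

End Branches.

Section BaseMap.
Variables (R : realType) (r : \bar R) (A : finType) (T : gGIET R A).
Hypotheses (r0 : (0%:E <= r)%E) (hT : is_gGIET r T).
Let X := measurableTypeR R.

Lemma topI_neq0 a : a \in letters T -> tl T a < tr T a.
Proof. by case: hT => _ h _ _ _ /h[_ /andP[]]. Qed.

Lemma branchP a : a \in letters T ->
  exists F G : R -> R,
    [/\ continuous F /\ continuous G,
        {in `[tl T a, tr T a[, T =1 F},
        {in `[tl T a, tr T a[ &, {mono T : x y / x <= y}},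
        T @` topI T a = botI T a &
        {in `[tl T a, tr T a[, cancel T G}].
Proof.
move=> aT; apply: (Cr_diffeo_extP r0) (topI_neq0 aT) _.
by case: hT => _ _ _ _; exact.
Qed.

Lemma topI_inj a b x : a \in letters T -> b \in letters T ->
  topI T a x -> topI T b x -> a = b.
Proof.
case: hT => _ _ _ [tt _] _ aT bT ax bx.
by apply: (tt a b) => //; exists x.
Qed.

Lemma botI_inj a b x : a \in letters T -> b \in letters T ->
  botI T a x -> botI T b x -> a = b.
Proof.
case: hT => _ _ _ [_ tt] _ aT bT ax bx.
by apply: (tt a b) => //; exists x.
Qed.

Lemma map_botI a x : a \in letters T -> topI T a x -> botI T a (T x).
Proof. by move=> /branchP[F [G [_ _ _ <- _]]] ax; exists x. Qed.

Lemma botI_preim a x : a \in letters T -> topI T a x ->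
  forall b, b \in letters T -> botI T b (T x) -> a = b.
Proof. by move=> aT /(map_botI aT) ax b bT bx; exact: (botI_inj aT bT ax bx). Qed.

Lemma injective_gGIET : {in Itop T &, injective T}.
Proof.
move=> x y; rewrite !inE => -[a aT ax] [b bT bx] Txy.
have ab : a = b by apply: (botI_preim aT ax) => //; rewrite Txy; exact: map_botI.
have [F [G [_ _ _ _ TG]]] := branchP aT.
by rewrite -(TG x)// -(TG y) ?Txy// ab.
Qed.

Lemma image_Itop : T @` Itop T = Ibot T.
Proof.
apply/seteqP; split => [_ [x [a aT ax] <-]|y [a aT ay]].
  by exists a => //; exact: map_botI.
have [F [G [_ _ _ im _]]] := branchP aT.
by move: ay; rewrite -im => -[x ax <-]; exists x => //; exists a.
Qed.

Lemma measurable_topI a : measurable (topI T a : set X).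
Proof. exact: measurable_itv. Qed.

Lemma measurable_botI a : measurable (botI T a : set X).
Proof. exact: measurable_itv. Qed.

Lemma measurable_Itop : measurable (Itop T : set X).
Proof. by apply: fin_bigcup_measurable => // a _; exact: measurable_topI. Qed.

Lemma measurable_Ibot : measurable (Ibot T : set X).
Proof. by apply: fin_bigcup_measurable => // a _; exact: measurable_botI. Qed.

(** Extension by the identity gives a total Borel map of the line, without changing anything for
    measures carried by [Itop T]. *)
Definition base_map (x : X) : X := if x \in Itop T then T x else x.

Lemma base_mapE x : Itop T x -> base_map x = T x.
Proof. by move=> xT; rewrite /base_map mem_set. Qed.

Lemma continuous_measurable_preimage (F : R -> R) (E : set X) : continuous F ->
  measurable E -> measurable (F @^-1` E : set X).
Proof.
move=> cF mE; have := continuous_measurable_fun cF.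
by move=> /(_ measurableT E mE); rewrite setTI.
Qed.

Lemma measurable_base_map : measurable_fun setT base_map.
Proof.
move=> _ E mE; rewrite setTI.
rewrite (_ : _ @^-1` _ = (\bigcup_(a in [set` letters T])
    (topI T a `&` T @^-1` E)) `|` (E `\` Itop T)); last first.
  apply/seteqP; split => [x|x [[a aT [ax Ex]]|[Ex xT]]].
  - rewrite /preimage /base_map /=; case: ifPn => [/set_mem[a aT ax] Ex|/negP xT Ex].
      by left; exists a.
    by right; split => // /mem_set.
  - by rewrite /preimage/= base_mapE//; exists a.
  - by rewrite /preimage /base_map/= memNset.
apply: measurableU; last by apply: measurableD => //; exact: measurable_Itop.
apply: fin_bigcup_measurable => // a aT.
have [F [G [[cF _] TF _ _ _]]] := branchP aT.
rewrite (_ : _ `&` _ = topI T a `&` F @^-1` E).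
  by apply: measurableI; [exact: measurable_topI|exact: continuous_measurable_preimage].
by apply/seteqP; split => x [ax]; rewrite /preimage /= TF.
Qed.

(** On each top interval the image is cut out by a preimage under the continuous inverse branch [G].
    This is what makes the inverse of a GIET measurable. *)
Lemma measurable_base_map_image E : measurable E ->
  measurable (T @` (E `&` Itop T) : set X).
Proof.
move=> mE.
rewrite (_ : _ @` _ = \bigcup_(a in [set` letters T]) (T @` (E `&` topI T a))).
  apply: fin_bigcup_measurable => // a aT.
  have [F [G [[_ cG] _ _ im TG]]] := branchP aT.
  rewrite (_ : _ @` _ = botI T a `&` G @^-1` E).
    by apply: measurableI; [exact: measurable_botI|exact: continuous_measurable_preimage].
  apply/seteqP; split => [_ [x [Ex ax] <-]|y []].
    by split; [exact: map_botI|rewrite /preimage /= TG].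
  by rewrite -im /preimage => -[x ax <-] /=; rewrite TG// => Ex; exists x.
apply/seteqP; split => [_ [x [Ex [a aT ax]] <-]|_ [a aT [x [Ex ax] <-]]].
  by exists a => //; exists x.
by exists x => //; split => //; exists a.
Qed.

End BaseMap.

(** * The bound on a base g-GIET *)

(** Comparing points of two disjoint intervals does not depend on the points chosen: hence the
    displacement of [cumul] is constant on each top interval. *)
Lemma le_disjoint_itv (R : realType) (l1 r1 l2 r2 x y : R) :
  (forall z, ~ (`[l1, r1[%classic z /\ `[l2, r2[%classic z)) ->
  x \in `[l1, r1[ -> y \in `[l2, r2[ -> (x <= y) = (l1 < l2).
Proof.
rewrite !in_itv /= => disj /andP[l1x xr1] /andP[l2y yr2].
have [l12|l21] := ltP l1 l2.
  rewrite leNgt; apply/negP => yx; apply: (disj y); split; rewrite /= in_itv /=.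
    by rewrite (le_trans (ltW l12) l2y) (lt_trans yx).
  by rewrite l2y.
apply/negP => xy; apply: (disj x); split; rewrite /= in_itv /=.
  by rewrite l1x.
by rewrite (le_trans l21 l1x) (le_lt_trans xy).
Qed.

Section BaseBound.
Variables (R : realType) (r : \bar R) (B : finType) (T : gGIET R B).
Hypotheses (r0 : (0%:E <= r)%E) (hT : is_gGIET r T).
Let X := measurableTypeR R.
Let f : X -> X := base_map T.

Section OneMeasure.
Variable nu : {finite_measure set X -> \bar R}.
Hypotheses (nuJ : nu (~` Itop T) = 0%E) (nuf : invariant_measure f nu).

Definition top_lengths (mu : set X -> \bar R) (b : B) : R := fine (mu (topI T b)).

(** The vector delta: the displacement of [b] in an IET with the same orders of intervals and with
    lengths [top_lengths mu]. It is linear in these lengths. *)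
Definition translation (mu : set X -> \bar R) (b : B) : R :=
  \sum_(a in letters T)
    ((bl T a < bl T b)%R%:R - (tl T a < tl T b)%R%:R) * top_lengths mu a.

Lemma fine_measure_topI E : measurable E ->
  fine (nu E) = \sum_(a in letters T) fine (nu (E `&` topI T a)).
Proof.
move=> mE; rewrite (fine_measureDI nu mE (measurable_Itop T)).
have -> : nu (E `\` Itop T) = 0%E.
  apply: (null_subset _ _ _ nuJ).
  - exact: (measurableD mE (measurable_Itop T)).
  - exact: measurableC (measurable_Itop T).
  - by move=> x [].
rewrite add0r.
rewrite /Itop setI_bigcupr fine_measure_sum//.
  by move=> a; apply: measurableI => //; exact: measurable_topI.
case: hT => _ _ _ [tt _] _ a b aT bT [x [[_ ax] [_ bx]]].
by apply: (tt a b) => //; exists x.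
Qed.

(** By invariance [cumul nu (f x)] is the mass of the points sent to the left of [f x] or onto it. A
    top interval other than that of [x] counts entirely or not at all; that of [x] contributes
    equally to both terms, its branch being increasing. *)
Lemma cumul_base_map b x : b \in letters T -> topI T b x ->
  cumul nu (f x) - cumul nu x = translation nu b.
Proof.
move=> bT bx; have mI z : measurable (`]-oo, z]%classic : set X) by exact: measurable_itv.
have mf := measurable_base_map r0 hT.
rewrite /cumul -nuf// !fine_measure_topI//; last exact: measurable_preimage.
rewrite -sumrB; apply: eq_bigr => a aT.
have Ix : Itop T x by exists b.
have fx : f x = T x by exact: base_mapE.
have [ab|ab] := eqVneq a b.
  subst a; rewrite !ltxx subrr mul0r; apply/eqP; rewrite subr_eq0; apply/eqP.
  congr (fine (nu _)); apply/seteqP; split => y [/= hy by_]; split => //; move: hy;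
    have [F [G [_ _ mono _ _]]] := branchP r0 hT bT;
    by rewrite !in_itv /= fx [f y]base_mapE ?mono//; exists b.
have E1 : fine (nu (f @^-1` `]-oo, f x]%classic `&` topI T a)) =
    (bl T a < bl T b)%R%:R * top_lengths nu a.
  have leE y : topI T a y -> (f y <= f x) = (bl T a < bl T b).
    move=> ay; rewrite fx [f y]base_mapE; last by exists a.
    apply: (le_disjoint_itv (r1 := br T a) (r2 := br T b)).
    - by move=> z [za zb]; move/eqP: ab; apply; exact: (botI_inj hT aT bT za zb).
    - exact: (map_botI r0 hT aT ay).
    - exact: (map_botI r0 hT bT bx).
  case: ltP leE => h leE; rewrite ?mul1r ?mul0r.
    congr (fine (nu _)); apply/seteqP; split => [y []//|y ay]; split => //.
    by rewrite /preimage /= in_itv /= leE.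
  rewrite (_ : _ `&` _ = set0) ?measure0//; apply/seteqP; split => // y [+ ay].
  by rewrite /preimage /= in_itv /= leE.
have E2 : fine (nu (`]-oo, x]%classic `&` topI T a)) =
    (tl T a < tl T b)%R%:R * top_lengths nu a.
  have leE y : topI T a y -> (y <= x) = (tl T a < tl T b).
    move=> ay; apply: (le_disjoint_itv (r1 := tr T a) (r2 := tr T b)) => //.
    by move=> z [za zb]; move/eqP: ab; apply; exact: (topI_inj hT aT bT za zb).
  case: ltP leE => h leE; rewrite ?mul1r ?mul0r.
    congr (fine (nu _)); apply/seteqP; split => [y []//|y ay]; split => //.
    by rewrite /= in_itv /= leE.
  rewrite (_ : _ `&` _ = set0) ?measure0//; apply/seteqP; split => // y [+ ay].
  by rewrite /= in_itv /= leE.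
by rewrite E1 E2 -mulrBl.
Qed.

(** Off [Itop T] the map is the identity and both sides vanish, so the formula holds everywhere and
    can be integrated. *)
Lemma cumul_base_mapE x : cumul nu (f x) - cumul nu x =
  \sum_(b in letters T) translation nu b * \1_(topI T b) x.
Proof.
have [[a aT ax]|nx] := pselect (Itop T x).
  rewrite (bigD1 a)//= big1 ?addr0 => [|b /andP[bT ba]].
    by rewrite indicE mem_set// mulr1 (cumul_base_map aT ax).
  rewrite indicE memNset ?mulr0// => bx.
  by move/eqP: ba; apply; exact: (topI_inj hT bT aT bx ax).
rewrite /f /base_map memNset// subrr big1// => b bT.
by rewrite indicE memNset ?mulr0// => bx; apply: nx; exists b.
Qed.

End OneMeasure.

(* Integrating cumul mu \o f - cumul mu, which is the translation by mu on
   each top interval, against the f-invariant measure nu gives 0. *)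
Lemma top_lengths_translation (nu mu : {finite_measure set X -> \bar R}) :
  invariant_measure f nu ->
  mu (~` Itop T) = 0%E -> invariant_measure f mu -> (forall x, mu [set x] = 0%E) ->
  \sum_(b in letters T) top_lengths nu b * translation mu b = 0.
Proof.
move=> nuf muJ muf mu1.
have mf := measurable_base_map r0 hT.
have mG : measurable_fun setT (cumul mu : X -> R).
  exact: (continuous_measurable_fun (continuous_cumul mu1)).
have mGf : measurable_fun setT (cumul mu \o f : X -> R) by exact: measurableT_comp mf.
have ibd (g : X -> R) : measurable_fun setT g ->
    (forall x, `|g x| <= fine (mu setT)) -> nu.-integrable setT (EFin \o g).
  move=> mg gb; apply: measurable_bounded_integrable => //.
    by rewrite ltey_eq fin_num_measure.
  exists (fine (mu setT)); split; first by rewrite num_real.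
  by move=> M /ltW KM x _ /=; exact: le_trans KM.
have iG : nu.-integrable setT (EFin \o (cumul mu : X -> R)).
  by apply: ibd => // x; exact: cumul_bounded.
have iGf : nu.-integrable setT (EFin \o (cumul mu \o f)).
  by apply: ibd => // x; exact: cumul_bounded.
have inteq : (\int[nu]_x (cumul mu (f x))%:E = \int[nu]_x (cumul mu x)%:E)%E.
  transitivity (\int[pushforward nu f]_x (cumul mu x)%:E)%E.
    rewrite integral_pushforward//; exact/measurable_EFinP.
  apply: eq_measure_integral => E mE _; exact: nuf.
have int0 : (\int[nu]_x (\sum_(b in letters T) translation mu b * \1_(topI T b) x)%:E = 0)%E.
  under eq_integral do rewrite -cumul_base_mapE// EFinB.
  rewrite integralB_EFin//= inteq subee//.
  exact: integrable_fin_num.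
apply: EFin_inj; rewrite -[RHS]/(0%E) -{}int0 -sumEFin.
under [RHS]eq_integral do rewrite -sumEFin.
rewrite integral_sum//; last first.
  move=> b; under eq_fun do rewrite EFinM.
  by apply: integrableZl => //; apply: integrable_indic; exact: measurable_topI.
apply: eq_bigr => b bT; under [RHS]eq_integral do rewrite EFinM.
rewrite integralZl//; last by apply: integrable_indic; exact: measurable_topI.
rewrite integral_indic//; last exact: measurable_topI.
rewrite setIT EFinM muleC /top_lengths fineK_measure//; exact: measurable_topI.
Qed.

End BaseBound.

(** * Linear independence of the translation vectors and the rank bound *)

Section ErgodicBound.
Variables (R : realType) (r : \bar R) (B : finType) (T : gGIET R B).
Hypotheses (r0 : (0%:E <= r)%E) (hT : is_gGIET r T).
Let X := measurableTypeR R.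
Let f : X -> X := base_map T.

Variables (m : nat) (nu : 'I_m -> {finite_measure set X -> \bar R}).
Hypotheses (nuJ : forall i, nu i (~` Itop T) = 0%E)
  (nu1 : forall i x, nu i [set x] = 0%E)
  (nuf : forall i, invariant_measure f (nu i))
  (nue : forall i, ergodic f (nu i))
  (nuS : forall i, exists S, [/\ measurable S, nu i S != 0%E &
     forall j, j != i -> nu j S = 0%E]).

Lemma Itop_itv01 x : Itop T x -> 0 <= x < 1.
Proof.
case: hT => _ h _ _ _ [a /h[tl0 /andP[_ tr1]]]; rewrite /topI /= in_itv /= => /andP[h1 h2].
by rewrite (le_trans tl0 h1) (lt_le_trans h2 tr1).
Qed.

(** Such a relation makes [ccumul nu c] invariant under [f], hence constant almost everywhere for
    each [nu i]. This forces it, and then the signed measure, to vanish; a set charged by [nu i]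
    alone then gives [c i = 0]. *)
Lemma translation_linear_independent (c : 'I_m -> R) :
  (forall b, b \in letters T -> \sum_i c i * translation T (nu i) b = 0) ->
  forall i, c i = 0.
Proof.
move=> c0 i.
have inv (e : 'I_m -> R) : (forall b, b \in letters T ->
    \sum_i e i * translation T (nu i) b = 0) ->
    forall x, ccumul nu e (f x) = ccumul nu e x.
  move=> e0 x; apply/eqP; rewrite -subr_eq0 /ccumul -sumrB; apply/eqP.
  under eq_bigr do rewrite -mulrBr (cumul_base_mapE r0 hT (nuJ _) (nuf _)) mulr_sumr.
  rewrite exchange_big big1//= => b bT.
  by under eq_bigr do rewrite mulrA; rewrite -mulr_suml e0// mul0r.
have nuJ0 j (E : set X) : measurable E -> (forall x, E x -> ~ (0 <= x < 1)) ->
    nu j E = 0%E.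
  move=> mE E01; apply: (null_subset mE _ _ (nuJ j)).
    exact: measurableC (measurable_Itop T).
  by move=> x Ex /Itop_itv01; exact: E01.
(* The measures live in [[0, 1[]; -1 will be the starting point required by [ccumul_le0]. *)
have neg (e : 'I_m -> R) x : x <= -1 -> ccumul nu e x = 0.
  move=> x1; rewrite /ccumul big1// => j _; rewrite /cumul nuJ0 ?mulr0//.
  by move=> y; rewrite /= in_itv /= => yx /andP[y0 _]; lra.
have le0 (e : 'I_m -> R) : (forall b, b \in letters T ->
    \sum_i e i * translation T (nu i) b = 0) ->
    forall x, ccumul nu e x <= 0.
  move=> e0.
  have /choice[k hk] j : exists k, nu j [set x | ccumul nu e x != k] = 0%E.
    apply: (ergodic_ae_constant (nue j) (K := \sum_i `|e i| * fine (nu i setT))).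
    - exact: (continuous_measurable_fun (continuous_ccumul nu1)).
    - move=> x; apply: le_trans (ler_norm_sum _ _ _) _; apply: ler_sum => l _.
      by rewrite normrM ler_wpM2l// cumul_bounded.
    - exact: inv.
  exact: (ccumul_le0 nu1 (neg e) hk).
have G0 x : ccumul nu c x = 0.
  (* The reverse inequality is the same bound for the opposite coefficients. *)
  apply/eqP; rewrite eq_le le0//= -oppr_le0.
  have -> : - ccumul nu c x = ccumul nu (fun i => - c i) x.
    by rewrite /ccumul -sumrN; apply: eq_bigr => j _; rewrite mulNr.
  apply: le0 => b bT; under eq_bigr do rewrite mulNr.
  by rewrite sumrN c0// oppr0.
(* No mass lies beyond 1, so the total mass is the value of [ccumul] at 1. *)
have GT : \sum_i c i * fine (nu i setT) = 0.
  rewrite -[RHS](G0 1); apply: eq_bigr => j _; congr (_ * _).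
  rewrite (@fine_measureDI _ _ _ (nu j) setT `]-oo, 1]%classic)// setTI setTD setCitvl.
  rewrite nuJ0 ?add0r//.
  by move=> y; rewrite /= in_itv /= andbT => y1 /andP[_ y1']; lra.
have [S [mS Si Sj]] := nuS i.
have := ccumul_eq0 G0 GT mS.
rewrite (bigD1 i)//= big1 ?addr0 => [/eqP|j ji]; last by rewrite Sj// mulr0.
rewrite mulf_eq0 => /orP[/eqP//|/eqP nuS0]; move: Si.
by rewrite (fine_measure_eq0 mS nuS0) eqxx.
Qed.

(** The lengths form the rows of [La] and the translations those of [De]. Both have rank [m], and
    [La *m De^T = 0] bounds the sum of the ranks by the number of letters. *)
Lemma ergodic_base_bound : (m * 2 <= #|letters T|)%N.
Proof.
pose d := #|letters T|; pose ev (j : 'I_d) : B := enum_val j.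
have evL j : ev j \in letters T by exact: enum_valP.
pose La : 'M[R]_(m, d) := \matrix_(i, j) top_lengths T (nu i) (ev j).
pose De : 'M[R]_(m, d) := \matrix_(i, j) translation T (nu i) (ev j).
have freeD : row_free De.
  apply: inj_row_free => v vD; apply/rowP => i; rewrite mxE.
  apply: (translation_linear_independent (c := v 0)) => b bT.
  move/matrixP : vD => /(_ 0 (enum_rank_in bT b)); rewrite !mxE => vD.
  rewrite -[RHS]vD; apply: eq_bigr => j _; rewrite mxE /ev.
  by rewrite enum_rankK_in.
(* Translations being linear in lengths, a relation between rows of [La] is also one between rows of
   [De]. *)
have freeL : row_free La.
  apply: inj_row_free => v vL; apply/rowP => i; rewrite mxE.
  apply: (translation_linear_independent (c := v 0)) => b bT.
  rewrite /translation; under eq_bigr do rewrite mulr_sumr.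
  rewrite exchange_big big1//= => a aT; under eq_bigr do rewrite mulrCA.
  rewrite -mulr_sumr; move/matrixP : vL => /(_ 0 (enum_rank_in aT a)).
  rewrite !mxE => vL; rewrite -[X in _ * X = _](_ : 0 = _) ?mulr0//.
  rewrite -[LHS]vL; apply: eq_bigr => j _; rewrite mxE /ev.
  by rewrite enum_rankK_in.
have LD : La *m De^T = 0.
  apply/matrixP => i j; rewrite !mxE.
  under eq_bigr do rewrite !mxE.
  rewrite -[RHS](top_lengths_translation r0 hT (nuf i) (nuJ j) (nuf j) (nu1 j)).
  by rewrite [RHS]big_enum_val.
have := mulmx0_rank_max LD; rewrite mxrank_tr.
by move: freeL freeD; rewrite /row_free => /eqP -> /eqP ->; rewrite addnn muln2.
Qed.

End ErgodicBound.

(** * Towers *)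

Section Tower.
Variables (R : realType) (r : \bar R) (B : finType) (Tb : gGIET R B).
Hypotheses (r0 : (0%:E <= r)%E) (hTb : is_gGIET r Tb).
Let X := measurableTypeR R.
Variables (P g : X -> X) (mu : probability X R) (Rec : set X) (n : B -> nat).
Hypotheses (mP : measurable_fun setT P) (mg : measurable_fun setT g)
  (PK : cancel P g) (gK : cancel g P)
  (iP : invariant_measure P mu) (eP : ergodic P mu)
  (mRec : measurable Rec) (muRec : mu (~` Rec) = 0%E)
  (n_gt0 : forall b, b \in letters Tb -> (0 < n b)%N)
  (TbE : forall b x, b \in letters Tb -> topI Tb b x -> Tb x = iter (n b) P x)
  (disjoint_floors : forall b c j k x z, b \in letters Tb -> c \in letters Tb ->
    (j < n b)%N -> (k < n c)%N -> topI Tb b x -> topI Tb c z ->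
    iter j P x = iter k P z -> b = c /\ j = k)
  (cover_floors : forall y, Rec y -> exists b j x,
    [/\ b \in letters Tb, (j < n b)%N, topI Tb b x & y = iter j P x]).
Let f : X -> X := base_map Tb.

Lemma invariant_measure_inv : invariant_measure g mu.
Proof.
move=> E mE; rewrite -iP; last exact: measurable_preimage.
by congr (mu _); apply/seteqP; split => x; rewrite /preimage /= PK.
Qed.

Lemma ergodic_inv : ergodic g mu.
Proof.
move=> E mE gE; apply: eP => //.
by rewrite -{1}gE; apply/seteqP; split => x; rewrite /preimage /= PK.
Qed.

Lemma base_mapP b x : b \in letters Tb -> topI Tb b x -> f x = iter (n b) P x.
Proof. by move=> bT bx; rewrite /f base_mapE ?(TbE bT bx)//; exists b. Qed.

(** If [y] were on a floor [j > 0], one step back would put the same point on the last floor of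
    tower [b] and on floor [j - 1]. Disjointness identifies these floors, and [j] would equal the
    height of its tower. *)
Lemma Ibot_sub_Itop y : Ibot Tb y -> Rec y -> Itop Tb y.
Proof.
rewrite -(image_Itop r0 hTb) => -[x [b bT bx] <-] /cover_floors[c [j [z [cT jn cz]]]].
rewrite (TbE bT bx); case: j jn cz => [_ cz ->|j jn cz xz]; first by exists c.
have [n' n'E] : exists n', n b = n'.+1 by exists (n b).-1; rewrite prednK// n_gt0.
move: xz; rewrite n'E !iterS => /(can_inj PK) xz.
have n'n : (n' < n b)%N by rewrite n'E.
have [bc n'j] := disjoint_floors bT cT n'n (ltnW jn) bx cz xz.
by move: jn; rewrite -bc n'E n'j ltnn.
Qed.

Lemma null_Ibot_Itop : mu (Ibot Tb `\` Itop Tb) = 0%E.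
Proof.
apply: (null_subset _ _ _ muRec).
- exact: measurableD (measurable_Ibot Tb) (measurable_Itop Tb).
- exact: measurableC.
- by move=> y [yb yt] /= yR; apply: yt; exact: Ibot_sub_Itop.
Qed.

(** On the top interval of [b] the map is the injective iterate [iter (n b) P], which preserves
    [mu]; the branches are then summed. *)
Lemma measure_preimage_base_map E : measurable E ->
  mu (f @^-1` E `&` Itop Tb) = mu (E `&` Ibot Tb).
Proof.
move=> mE; have mf := measurable_base_map r0 hTb.
have mfE := measurable_preimage mf mE.
rewrite -[LHS]fineK_measure; last by apply: measurableI => //; exact: measurable_Itop.
rewrite -[RHS]fineK_measure; last by apply: measurableI => //; exact: measurable_Ibot.
congr EFin; rewrite /Itop /Ibot !setI_bigcupr !fine_measure_sum//.
- apply: eq_bigr => b bT; congr fine.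
  transitivity (mu (iter (n b) P @^-1` (E `&` botI Tb b))); last first.
    apply: invariant_measure_iter => //.
    by apply: measurableI => //; exact: measurable_botI.
  congr (mu _); apply/seteqP; split => x.
    move=> [Ex bx]; rewrite /preimage /=; split; first by rewrite -(base_mapP bT bx).
    by rewrite -(TbE bT bx); exact: (map_botI r0 hTb bT bx).
  have [F [G [_ _ _ im _]]] := branchP r0 hTb bT.
  rewrite /preimage /= -im => -[Ex [z bz]]; rewrite (TbE bT bz) => zx.
  have {zx} zx : z = x by apply: (can_inj (cancel_iter (n b) PK)).
  by subst z; split => //; rewrite (base_mapP bT bz).
- by move=> b; apply: measurableI => //; exact: measurable_botI.
- case: hTb => _ _ _ [_ tt] _ a b aT bT [x [[_ ax] [_ bx]]].
  by apply: (tt a b) => //; exists x.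
- by move=> b; apply: measurableI => //; exact: measurable_topI.
- case: hTb => _ _ _ [tt _] _ a b aT bT [x [[_ ax] [_ bx]]].
  by apply: (tt a b) => //; exists x.
Qed.

(** The preceding identity gives the two unions the same finite mass, and the opposite difference is
    already null. *)
Lemma null_Itop_Ibot : mu (Itop Tb `\` Ibot Tb) = 0%E.
Proof.
apply: eq_measure_setD0 null_Ibot_Itop; [exact: measurable_Ibot|exact: measurable_Itop|].
by have := measure_preimage_base_map measurableT; rewrite preimage_setT !setTI => /esym.
Qed.

Lemma measure_Ibot_Itop E : measurable E -> mu (E `&` Ibot Tb) = mu (E `&` Itop Tb).
Proof.
move=> mE; have mt := measurable_Itop Tb; have mb := measurable_Ibot Tb.
have mEt : measurable (E `&` Itop Tb) by exact: measurableI.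
have mEb : measurable (E `&` Ibot Tb) by exact: measurableI.
have h1 : mu ((E `&` Ibot Tb) `\` Itop Tb) = 0%E.
  apply: (null_subset _ _ _ null_Ibot_Itop); [exact: measurableD|exact: measurableD|].
  by move=> x [[]].
have h2 : mu ((E `&` Itop Tb) `\` Ibot Tb) = 0%E.
  apply: (null_subset _ _ _ null_Itop_Ibot); [exact: measurableD|exact: measurableD|].
  by move=> x [[]].
rewrite -[LHS]fineK_measure// -[RHS]fineK_measure//; congr EFin.
transitivity (fine (mu (E `&` Ibot Tb `&` Itop Tb))).
  by rewrite (fine_measureDI mu mEb mt) -[RHS]add0r; congr (_ + _); exact: (congr1 fine h1).
rewrite setIAC; apply/esym.
by rewrite (fine_measureDI mu mEt mb) -[RHS]add0r; congr (_ + _); exact: (congr1 fine h2).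
Qed.

(** Every point of [Rec] is an iterate of a base point, so a null base would make the whole line
    null. *)
Lemma measure_base_gt0 : mu (Itop Tb) != 0%E.
Proof.
apply/eqP => mu0.
have : mu setT = 0%E.
  apply/negligibleP => //.
  apply: (@negligibleS _ _ _ mu (~` Rec `|` \bigcup_k (iter k g @^-1` Itop Tb))).
    move=> y _; have [/cover_floors[b [j [x [bT _ bx ->]]]]|] := pselect (Rec y); last by left.
    by right; exists j => //; rewrite /preimage /= (cancel_iter j PK); exists b.
  apply: negligibleU; first by apply/negligibleP => //; exact: measurableC.
  apply: negligible_bigcup => k; apply/negligibleP.
    by apply: measurable_preimage_iter => //; exact: measurable_Itop.
  rewrite (invariant_measure_iter k mg)//; first exact: invariant_measure_inv.
  exact: measurable_Itop.
by rewrite probability_setT => /eqP; rewrite onee_eq0.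
Qed.

Let muoo : (mu (Itop Tb) < +oo)%E.
Proof. by rewrite ltey_eq fin_num_measure//; exact: measurable_Itop. Qed.

Definition base_measure : {finite_measure set X -> \bar R} :=
  mfrestr (measurable_Itop Tb) muoo.

Lemma base_measureE E : base_measure E = mu (E `&` Itop Tb). Proof. by []. Qed.

Lemma invariant_base_measure : invariant_measure f base_measure.
Proof.
move=> E mE.
by rewrite !base_measureE measure_preimage_base_map// measure_Ibot_Itop.
Qed.

(* A base-invariant set E spreads along the towers to a set which P can leave
   only through Ibot Tb minus Itop Tb. *)
Lemma ergodic_base_measure : ergodic f base_measure.
Proof.
move=> E mE fE; rewrite !base_measureE.
pose J k := \bigcup_(b in [set b | b \in letters Tb /\ (k < n b)%N]) topI Tb b.
have mJ k : measurable (J k : set X).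
  by apply: fin_bigcup_measurable => // b _; exact: measurable_topI.
(* The part of the towers above [E], written with preimages under [g] so that it is visibly
   measurable. *)
pose E' := \bigcup_k (iter k g @^-1` (E `&` J k)).
have mE' : measurable E'.
  by apply: bigcup_measurable => k _; apply: measurable_preimage_iter => //; exact: measurableI.
have E'P y : E' y -> exists b k x,
    [/\ b \in letters Tb, (k < n b)%N, topI Tb b x, E x & y = iter k P x].
  move=> [k _ [Ey [b [bT kn] bx]]]; exists b, k, (iter k g y); split => //.
  by rewrite (cancel_iter k gK).
have E'I b k x : b \in letters Tb -> (k < n b)%N -> topI Tb b x -> E x -> E' (iter k P x).
  move=> bT kn bx Ex; exists k => //; rewrite /preimage /= (cancel_iter k PK).
  by split => //; exists b.
(* A point leaving [E'] comes from the last floor of a tower, so it lands in [Ibot Tb]. Were it in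
   [Itop Tb], invariance of [E] would put it on floor 0 of [E']. *)
have null : mu (g @^-1` E' `\` E') = 0%E.
  apply: (null_subset _ _ _ null_Ibot_Itop).
  - by apply: measurableD => //; exact: measurable_preimage.
  - exact: measurableD (measurable_Ibot Tb) (measurable_Itop Tb).
  - move=> y [/E'P[b [k [x [bT kn bx Ex]]]] gy] E'y.
    have {gy} yE : y = iter k.+1 P x by rewrite iterS -gy gK.
    have [kn'|nk] := ltnP k.+1 (n b); first by exfalso; apply: E'y; rewrite yE; exact: (E'I b).
    have {nk} nE : n b = k.+1 by apply/eqP; rewrite eqn_leq nk kn.
    have {}yE : y = f x by rewrite (base_mapP bT bx) nE.
    split.
      have -> : y = Tb x by rewrite yE; apply: base_mapE; exists b.
      by exists b => //; exact: (map_botI r0 hTb bT bx).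
    move=> [c cT cy]; apply: E'y; rewrite -[y]/(iter 0 P y); apply: (E'I c) => //.
      exact: n_gt0.
    by rewrite yE -[E (f x)]/((f @^-1` E) x) fE.
have mI D : measurable D -> measurable (D `&` Itop Tb : set X).
  by move=> mD; apply: measurableI => //; exact: measurable_Itop.
have [h|h] := ergodic_ae mg invariant_measure_inv ergodic_inv mE' null; [left|right].
  apply: (null_subset _ _ _ h) => //; first exact: mI.
  move=> x [Ex [b bT bx]]; rewrite -[x]/(iter 0 P x); apply: (E'I b) => //.
  exact: n_gt0.
apply: (null_subset _ _ _ h); [exact: mI _ (measurableC mE)|exact: measurableC|].
(* Floors being disjoint, a base point of [E'] is on floor 0 and so belongs to [E]. *)
move=> x [Ex [b bT bx]] /E'P[c [k [z [cT kn cz Ez xz]]]]; apply: Ex.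
have [_ k0] := disjoint_floors bT cT (n_gt0 bT) kn bx cz xz.
by rewrite xz -k0.
Qed.

End Tower.

(** * Orbits and invariant measures of a GIET *)

Lemma measurable_right_open_union (R : realType) (J : set R) :
  right_open_union J -> measurable (J : set (measurableTypeR R)).
Proof.
move=> [s [_ ->]]; apply: fin_bigcup_measurable => [|p _]; first exact: finite_seq.
exact: measurable_itv.
Qed.

Section GIETMap.
Variables (R : realType) (r : \bar R) (A : finType) (T : gGIET R A).
Hypotheses (r0 : (0%:E <= r)%E) (hT : is_GIET r T).
Let X := measurableTypeR R.
Let P : X -> X := base_map T.

Let hT' : is_gGIET r T. Proof. by case: hT. Qed.

Lemma Itop_GIET x : Itop T x <-> 0 <= x < 1.
Proof. by case: hT => _ -> _; rewrite /= in_itv. Qed.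

Lemma base_map_itv01 x : 0 <= P x < 1 <-> 0 <= x < 1.
Proof.
rewrite -!Itop_GIET /P /base_map; case: ifPn => [/set_mem xT|//]; split => // _.
suff : Ibot T (T x) by case: hT => _ -> ->.
by rewrite -(image_Itop r0 hT'); exists x.
Qed.

Lemma base_map_injective : injective P.
Proof.
move=> x y Pxy; have [xT|nxT] := pselect (Itop T x).
  have yT : Itop T y by rewrite Itop_GIET -base_map_itv01 -Pxy base_map_itv01 -Itop_GIET.
  by apply: (injective_gGIET r0 hT'); rewrite ?inE//; move: Pxy; rewrite /P !base_mapE.
have nyT : ~ Itop T y by rewrite Itop_GIET -base_map_itv01 -Pxy base_map_itv01 -Itop_GIET.
by move: Pxy; rewrite /P /base_map !memNset.
Qed.

(** The extended map is a bijection of the line, and a preimage under its inverse is an image, Borel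
    branch by branch. *)
Lemma base_map_inverse : exists g : X -> X,
  [/\ measurable_fun setT g, cancel P g & cancel g P].
Proof.
have surj y : exists x, P x = y.
  have [yT|nyT] := pselect (Itop T y).
    have : Ibot T y by case: hT yT => _ -> ->.
    by rewrite -(image_Itop r0 hT') => -[x xT <-]; exists x; exact: base_mapE.
  by exists y; rewrite /P /base_map memNset.
have [g gK] := choice surj.
have PK : cancel P g by move=> x; apply: base_map_injective; rewrite gK.
exists g; split => // _ E mE; rewrite setTI.
rewrite (_ : g @^-1` E = (T @` (E `&` Itop T)) `|` (E `\` Itop T)).
  apply: measurableU; first exact: (measurable_base_map_image r0 hT').
  exact: measurableD mE (measurable_Itop T).
apply/seteqP; split => [y Ey|y [[x [Ex xT] <-]|]].
- have [gT|ngT] := pselect (Itop T (g y)).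
    by left; exists (g y) => //; rewrite -[RHS](gK y) /P base_mapE.
  by right; move: (gK y); rewrite /P /base_map memNset// => <-.
- by rewrite -(base_mapE xT) /preimage /= PK.
- by move=> [Ey yT]; rewrite /preimage /= -(_ : P y = y) ?PK// /P /base_map memNset.
Qed.

Lemma iter_base_map j x : 0 <= x < 1 -> iter j T x = iter j P x.
Proof.
move=> x01; elim: j => [//|j ih]; rewrite !iterS ih /P base_mapE//.
rewrite Itop_GIET; elim: j {ih} => [//|j ih]; rewrite iterS; exact/base_map_itv01.
Qed.

Section Restriction.
Variables (J : set R) (C : finType) (TJ : gGIET R C).
Hypothesis hJ : is_restriction T J TJ.

Lemma restriction_Itop : Itop TJ = J.
Proof.
case: hJ => JT comp _ cover _; apply/seteqP; split => x.
  move=> [c cT]; have [a [z [_ _ cE _]]] := comp _ cT; rewrite cE.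
  by move=> zx; have [Jx _] : (J `&` topI T a) x by exact: connected_component_sub zx.
move=> Jx; have [a aT ax] := JT _ Jx.
have [c cT cE] := cover a x aT (conj Jx ax).
exists c => //; rewrite cE; exact: connected_component_refl.
Qed.

Lemma restriction_Ibot : Ibot TJ = T @` J.
Proof.
rewrite -restriction_Itop; case: hJ => _ comp _ _ _; apply/seteqP; split.
  move=> y [c cT]; have [a [z [_ _ _ cE]]] := comp _ cT; rewrite cE.
  by move=> [x cx <-]; exists x => //; exists c.
move=> _ [x [c cT cx] <-]; exists c => //.
by have [a [z [_ _ _ cE]]] := comp _ cT; rewrite cE; exists x.
Qed.

Lemma restrictionE x : J x -> TJ x = P x.
Proof. by case: hJ => JT _ _ _ TE Jx; rewrite TE// /P base_mapE//; exact: JT. Qed.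

Lemma iterates_restriction k x y : iterates (right_open TJ) k x y <->
  (forall j, (j < k)%N -> J (iter j P x)) /\ iter k P x = y.
Proof.
rewrite /iterates /= restriction_Itop; split => -[h <-].
  have E j : (j <= k)%N -> iter j TJ x = iter j P x.
    elim: j => [//|j ih] jk; rewrite !iterS ih ?(ltnW jk)//.
    by apply: restrictionE; rewrite -ih ?(ltnW jk)//; exact: h.
  by split; [move=> j jk; rewrite -E ?(ltnW jk)//; exact: h|rewrite E].
have E j : (j <= k)%N -> iter j TJ x = iter j P x.
  elim: j => [//|j ih] jk; rewrite !iterS ih ?(ltnW jk)//.
  by apply: restrictionE; exact: h.
by split; [move=> j jk; rewrite E ?(ltnW jk)//; exact: h|rewrite E].
Qed.

Lemma transient_exit x : transient_orbit (right_open TJ) x ->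
  exists k, ~ J (iter k P x).
Proof.
move=> [_ [y [k /iterates_restriction[_ <-]] [_ nJ]] _].
by exists k; rewrite -restriction_Itop.
Qed.

(** A point leaving [J] in both time directions has a finite orbit under [TJ], ending in a top gap
    forward and in a bottom gap backward: it is transient. *)
Lemma recurrence_stay (g : X -> X) x : cancel P g -> cancel g P -> J x ->
  ~ transient_orbit (right_open TJ) x ->
  (forall k, J (iter k P x)) \/ (forall k, J (iter k g x)).
Proof.
move=> PK gK Jx ntr; apply: contrapT => /not_orP[/existsNP[n0 hn0] /existsNP[m0 hm0]].
apply: ntr.
have J01 y : J y -> 0 <= y < 1 by case: hJ => JT _ _ _ _ /JT /Itop_GIET.
have exn : exists n, `[< ~ J (iter n P x) >] by exists n0; exact/asboolP.
have exm : exists m, `[< ~ J (iter m g x) >] by exists m0; exact/asboolP.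
have [n /asboolP Jn minn] := ex_minnP exn.
have [m /asboolP Jm minm] := ex_minnP exm.
have {}minn j : (j < n)%N -> J (iter j P x).
  by move=> jn; apply: contrapT => /asboolP /minn; rewrite leqNgt jn.
have {}minm j : (j < m)%N -> J (iter j g x).
  by move=> jm; apply: contrapT => /asboolP /minm; rewrite leqNgt jm.
have m_gt0 : (0 < m)%N by case: m Jm {minm} => // /(_ Jx).
have Pg j k : iter j P (iter (j + k) g x) = iter k g x.
  by rewrite iterD (cancel_iter j gK).
split.
- rewrite /full_orbit finite_setU; split.
    apply: (@sub_finite_set _ _ ((fun j => iter j P x) @` `I_n.+1)); last first.
      exact/finite_image/finite_II.
    move=> y [k /iterates_restriction[hk <-]]; exists k => //=.
    by rewrite ltnS leqNgt; apply/negP => /hk.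
  apply: (@sub_finite_set _ _ ((fun j => iter j g x) @` `I_m)); last first.
    exact/finite_image/finite_II.
  move=> z [k /iterates_restriction[hk zx]]; exists k; last first.
    by rewrite /= -zx (cancel_iter k PK).
  rewrite /= ltnNge; apply/negP => mk; apply: Jm.
  suff -> : iter m g x = iter (k - m) P z.
    by apply: hk; rewrite ltn_subrL m_gt0 (leq_trans m_gt0).
  by rewrite -zx -{1}(subnKC mk) iterD (cancel_iter m PK).
- exists (iter n P x); first by exists n; exact/iterates_restriction.
  split; last by rewrite /= restriction_Itop.
  rewrite /= in_itv /=; elim: (n) => [|j ih]; first exact: J01.
  by rewrite iterS; exact/base_map_itv01.
(* The last backward iterate is at time [m - 1]: it is still in [J], but its preimage is not, so it
   lies outside the image of [J]. *)
- have m'm : (m.-1 < m)%N by rewrite prednK.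
  exists (iter m.-1 g x).
    exists m.-1; apply/iterates_restriction; split; last by rewrite (cancel_iter _ gK).
    move=> j jm; rewrite -(subnKC (ltnW jm)) Pg; apply: minm.
    exact: leq_ltn_trans (leq_subr _ _) m'm.
  split; first by rewrite /= in_itv /=; apply: J01; exact: minm.
  rewrite /= restriction_Ibot => -[w Jw]; rewrite -(base_mapE (T := T)); last first.
    exact/Itop_GIET/J01.
  by move=> wE; apply: Jm; rewrite -(prednK m_gt0) iterS -wE PK.
Qed.

End Restriction.

Section InvariantMeasure.
Variable mu : probability X R.
Hypothesis hmu : is_nonatomic_ergodic_invariant T mu.

Lemma null_compl_itv01 : mu (~` `[0, 1[%classic) = 0%E.
Proof.
by case: hmu => mu1 _ _ _; rewrite probability_setC ?mu1 ?subee.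
Qed.

Lemma measure_itv01 (E : set X) : measurable E -> mu (`[0, 1[%classic `&` E) = mu E.
Proof.
move=> mE; have mI : measurable (`[0, 1[%classic : set X) by exact: measurable_itv.
have mIE : measurable (`[0, 1[%classic `&` E : set X) by exact: measurableI.
rewrite -[LHS]fineK_measure// -[RHS]fineK_measure//; congr EFin.
rewrite (fine_measureDI mu mE mI) setIC -[LHS]add0r; congr (_ + _).
suff h : mu (E `\` `[0, 1[%classic) = 0%E by exact: (congr1 fine (esym h)).
apply: (null_subset _ _ _ null_compl_itv01); [exact: measurableD|exact: measurableC|].
by move=> x [].
Qed.

Let preimE E : `[0, 1[%classic `&` T @^-1` (`[0, 1[%classic `&` E) =
  `[0, 1[%classic `&` P @^-1` E.
Proof.
have TP x : 0 <= x < 1 -> T x = P x by move/Itop_GIET => xT; rewrite /P base_mapE.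
apply/seteqP; split => x; rewrite /preimage /= in_itv /=.
  by move=> [x01 [_ Ex]]; rewrite -TP.
by move=> [x01 Ex]; rewrite TP//; split => //; split => //; rewrite in_itv /=; exact/base_map_itv01.
Qed.

Lemma invariant_base_map : invariant_measure P mu.
Proof.
move=> E mE; have mP := measurable_base_map r0 hT'.
have mI : measurable (`[0, 1[%classic : set X) by exact: measurable_itv.
rewrite -measure_itv01; last exact: measurable_preimage.
rewrite -preimE -[RHS]measure_itv01//.
case: hmu => _ _ h _; apply: h; first exact: measurableI.
by move=> x [].
Qed.

Lemma ergodic_base_map : ergodic P mu.
Proof.
move=> E mE PE.
have mI : measurable (`[0, 1[%classic : set X) by exact: measurable_itv.
case: hmu => _ _ _ /(_ (`[0, 1[%classic `&` E)); rewrite preimE PE measure_itv01//.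
case=> [|x []//|//|->|muE]; [exact: measurableI|by left|].
by right; rewrite probability_setC// muE subee.
Qed.

End InvariantMeasure.

End GIETMap.

(** * Domains of a decomposition *)

(** [F] and its preimage have the same finite measure, so the inclusion is an equality up to a null
    set. *)
Lemma ergodic_subinvariant d (X : measurableType d) (R : realType)
    (f : X -> X) (mu : {finite_measure set X -> \bar R}) (F : set X) :
  measurable_fun setT f -> invariant_measure f mu -> ergodic f mu ->
  measurable F -> F `<=` f @^-1` F -> mu F = 0%E \/ mu (~` F) = 0%E.
Proof.
move=> mf imu emu mF Ff; apply: (ergodic_ae mf) => //.
apply: eq_measure_setD0 => //; first exact: measurable_preimage.
  by rewrite imu.
by rewrite (_ : F `\` _ = set0) ?measure0//; apply/seteqP; split => // x [/Ff].
Qed.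

Section Domains.
Variables (R : realType) (r : \bar R) (A : finType) (T : gGIET R A).
Hypotheses (r0 : (0%:E <= r)%E) (hT : is_GIET r T).
Let X := measurableTypeR R.
Let P : X -> X := base_map T.
Let hT' : is_gGIET r T. Proof. by case: hT. Qed.
Let mP : measurable_fun setT P. Proof. exact: (measurable_base_map r0 hT'). Qed.

Section OneMeasure.
Variables (mu : probability X R) (g : X -> X).
Hypotheses (hmu : is_nonatomic_ergodic_invariant T mu)
  (mg : measurable_fun setT g) (PK : cancel P g) (gK : cancel g P).
Let iP : invariant_measure P mu. Proof. exact: (invariant_base_map r0 hT hmu). Qed.
Let eP : ergodic P mu. Proof. exact: (ergodic_base_map r0 hT hmu). Qed.

(* Such a domain is the union of the points which stay in it forever forward
   and of those which stay in it forever backward. *)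
Lemma domain_of_recurrence_null (J : set R) : domain_of_recurrence T J ->
  mu J = 0%E \/ mu (~` J) = 0%E.
Proof.
move=> [/measurable_right_open_union mJ [C [TJ [hJ ntr]]]].
(* The points staying in [J] forever form a set mapped into itself; this is used for [P] and for its
   inverse. *)
have stay (f : X -> X) : measurable_fun setT f -> invariant_measure f mu -> ergodic f mu ->
    let F := \bigcap_k (iter k f @^-1` J) in measurable F /\ (mu F = 0%E \/ mu (~` F) = 0%E).
  move=> mf imu emu F.
  have mF : measurable F by apply: bigcapT_measurable => k; exact: measurable_preimage_iter.
  split => //; apply: (ergodic_subinvariant mf) => // x Fx k _.
  by rewrite /preimage /= -iterSr; exact: (Fx k.+1).
have [mF] := stay P mP iP eP.
have [mF'] := stay g mg (invariant_measure_inv mg PK iP) (ergodic_inv PK eP).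
set F := \bigcap_k _ in mF *; set F' := \bigcap_k _ in mF' *.
move=> hF' hF.
have FJ : F `<=` J by move=> x /(_ 0%N I).
have F'J : F' `<=` J by move=> x /(_ 0%N I).
have compl (S : set X) : measurable S -> S `<=` J -> mu (~` S) = 0%E -> mu (~` J) = 0%E.
  move=> mS SJ h; apply: (null_subset _ _ _ h); [exact: measurableC|exact: measurableC|].
  by move=> x /= Jx /SJ.
case: hF' => [hF'|hF']; last by right; exact: (compl F').
case: hF => [hF|hF]; last by right; exact: (compl F).
left; apply: (measure0_subsetU _ mF mF' _ hF hF') => // x Jx.
by have [h|h] := recurrence_stay r0 hT hJ PK gK Jx (ntr _ Jx); [left|right] => k _; exact: h.
Qed.

(** Otherwise every [Rd i] is null and [mu] is carried by [D]. But all points of [D] leave it, so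
    the preimages of its null complement cover the line. *)
Lemma exists_domain (k : nat) (D : set R) (Rd : 'I_k -> set R) :
  domain_of_transition T D -> (forall i, domain_of_recurrence T (Rd i)) ->
  `[0, 1[%classic = D `|` \bigcup_i Rd i -> exists i, mu (~` (Rd i)) = 0%E.
Proof.
move=> [/measurable_right_open_union mD [C [TD [hD tr]]]] rec cover.
apply: contrapT => /forallNP hn.
have Rd0 i : mu (Rd i) = 0%E by have [//|/hn] := domain_of_recurrence_null (rec i).
have mRd i : measurable (Rd i : set X).
  by have [/measurable_right_open_union] := rec i.
have D1 : mu (~` D) = 0%E.
  apply/negligibleP; first exact: measurableC.
  apply: (@negligibleS _ _ _ mu (~` `[0, 1[%classic `|` \big[setU/set0]_i Rd i)).
    move=> x Dx; have [x01|x01] := pselect (`[0, 1[%classic x); last by left.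
    right; move: x01; rewrite cover => -[//|[i _ xi]].
    by rewrite (bigD1 i)//=; left.
  apply: negligibleU.
    apply/negligibleP; last exact: (null_compl_itv01 hmu).
    by apply: measurableC; exact: measurable_itv.
  elim/big_ind: _ => [|? ? |i _]; [exact: negligible_set0|exact: negligibleU|].
  by apply/negligibleP; [exact: mRd|exact: Rd0].
have : mu setT = 0%E.
  apply/negligibleP => //.
  apply: (@negligibleS _ _ _ mu (\bigcup_n (iter n P @^-1` (~` D)))).
    move=> x _; have [Dx|nDx] := pselect (D x); last by exists 0%N.
    by have [n hn'] := transient_exit hD (tr _ Dx); exists n.
  apply: negligible_bigcup => n; apply/negligibleP.
    by apply: measurable_preimage_iter => //; exact: measurableC.
  by apply: etrans D1; apply: (invariant_measure_iter n mP iP); exact: measurableC.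
by rewrite probability_setT => /eqP; rewrite onee_eq0.
Qed.

End OneMeasure.

(** Distinct ergodic measures are mutually singular, and their restrictions to the base inherit what
    the rank bound requires. *)
Lemma tower_bound (Rec : set R) (B : finType) (Tb : gGIET R B) (m : nat)
    (mu : 'I_m -> probability X R) :
  is_gGIET r Tb -> right_open_union Rec -> tower_representation T Rec Tb ->
  (forall i, is_nonatomic_ergodic_invariant T (mu i)) ->
  (forall i, mu i (~` Rec) = 0%E) ->
  (forall i j, i != j -> exists2 E : set X, measurable E & mu i E != mu j E) ->
  (m * 2 <= #|letters Tb|)%N.
Proof.
move=> hTb /measurable_right_open_union mRec [n [[topT botT] n_gt0 floors [disj RecE] TbE]].
move=> hmu muRec mu_neq.
have [g [mg PK gK]] := base_map_inverse r0 hT.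
have top01 b x : b \in letters Tb -> topI Tb b x -> 0 <= x < 1.
  by move=> bT bx; apply/(Itop_GIET hT); apply: topT; exists b.
have iterP b j x : b \in letters Tb -> topI Tb b x -> iter j T x = iter j P x.
  by move=> bT bx; apply: (iter_base_map r0 hT); exact: (top01 b).
have TbP b x : b \in letters Tb -> topI Tb b x -> Tb x = iter (n b) P x.
  by move=> bT bx; rewrite (TbE b x bT bx); exact: (iterP b).
have dj b c j k x z : b \in letters Tb -> c \in letters Tb ->
    (j < n b)%N -> (k < n c)%N -> topI Tb b x -> topI Tb c z ->
    iter j P x = iter k P z -> b = c /\ j = k.
  move=> bT cT jn kn bx cz xz.
  have [-> ->//] : (b, j) = (c, k).
  apply: disj => //; exists (iter j P x); split.
    by exists x => //; exact: (iterP b).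
  by rewrite xz; exists z => //; exact: (iterP c).
have cov y : Rec y -> exists b j x,
    [/\ b \in letters Tb, (j < n b)%N, topI Tb b x & y = iter j P x].
  rewrite RecE => -[[b j] [/= bT jn] [x bx <-]]; exists b, j, x; split => //.
  exact: (iterP b).
have iP i := invariant_base_map r0 hT (hmu i).
have eP i := ergodic_base_map r0 hT (hmu i).
pose nu i := base_measure Tb (mu i).
(* The condition [i != j] is placed under the existential so that [S] can be chosen for all [j] at
   once. *)
have Sij i j : exists S : set X, i != j ->
    [/\ measurable S, mu i (~` S) = 0%E & mu j S = 0%E].
  have [->|ij] := eqVneq i j; first by exists setT.
  have [E mE Eij] := mu_neq _ _ ij.
  have [S hS] := ergodic_mutually_singular mP mg PK gK (iP i) (iP j) (eP i) (eP j) mE Eij.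
  by exists S.
have mt := measurable_Itop Tb.
apply: (ergodic_base_bound r0 hTb (nu := nu)).
- by move=> i; rewrite base_measureE setICl measure0.
- move=> i x; rewrite base_measureE; case: (hmu i) => _ /(_ x) h _ _.
  apply: (null_subset _ _ _ h) => [||y []//]; last exact: measurable_set1.
  by apply: measurableI => //; exact: measurable_set1.
- by move=> i; exact: (invariant_base_measure r0 hTb mP PK (iP i) mRec
    (muRec i) n_gt0 TbP dj cov).
- by move=> i; exact: (ergodic_base_measure r0 hTb mg PK gK (iP i) (eP i) mRec
    (muRec i) n_gt0 TbP dj cov).
- move=> i; have /choice[S hS] := Sij i.
  (* This set carries [mu i] and is null for all the other measures. *)
  pose S' := \big[setI/setT]_(j | i != j) S j.
  have mS' : measurable S'.
    by apply: bigsetI_measurable => j ij; have [] := hS j ij.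
  exists S'; split => //.
    rewrite base_measureE; apply/eqP => nuS0.
    have /eqP := measure_base_gt0 mg PK (iP i) mRec (muRec i) cov; apply.
    have S'C : mu i (~` S') = 0%E.
      apply/negligibleP; first exact: measurableC.
      rewrite /S' setC_bigsetI.
      elim/big_ind: _ => [|? ? |j ij]; [exact: negligible_set0|exact: negligibleU|].
      by have [mS h _] := hS j ij; apply/negligibleP => //; exact: measurableC.
    apply: (measure0_subsetU _ _ _ _ nuS0 S'C) => //; [exact: measurableI|exact: measurableC|].
    by move=> x xt; have [|] := pselect (S' x); [left|right].
  move=> j ji; have ij : i != j by rewrite eq_sym.
  rewrite base_measureE; have [mS _ h] := hS j ij.
  apply: (null_subset _ mS _ h); first exact: measurableI.
  by move=> x [S'x _]; move: S'x; rewrite /S' (bigD1 j)//= => -[].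
Qed.

End Domains.

(** * Counting the measures *)

(** Reduces finiteness and the bound to finite lists of distinct elements: an infinite [M] would
    contain such a list of length more than [N]. *)
Lemma card_le_bound (U : choiceType) (M : set U) (N : nat) :
  (forall s : seq U, uniq s -> {in s, forall x, M x} -> (size s <= N)%N) ->
  exists2 n : nat, (M #= `I_n)%card & (n <= N)%N.
Proof.
move=> bound; have [[n Mn]|infM] := pselect (finite_set M).
  exists n => //; rewrite -(card_fset_set Mn); apply: bound.
    exact: finmap.fset_uniq.
  have finM : finite_set M by exists n.
  by move=> x xM; apply/set_mem; rewrite -(in_fset_set finM); exact: xM.
have [F FM sF] := infinite_set_fset N.+1 infM.
have : (size (finmap.enum_fset F) <= N)%N.
  apply: bound; first exact: finmap.fset_uniq.
  by move=> x xF; apply: FM.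
by rewrite leqNgt sF.
Qed.

Theorem corollary1p5 (R : realType) (r : \bar R) (hr : (1%:E <= r)%E)
  (A : finType) (T : gGIET R A) (hT : is_GIET r T)
  (k q : nat) (D : set R) (Rd : 'I_k -> set R)
  (B : 'I_k -> finType) (Tb : forall i : 'I_k, gGIET R (B i))
  (hdec : dynamical_decomposition r T q D Rd Tb) :
  exists2 ET : nat,
    (nonatomic_ergodic_measures T #= `I_ET)%card &
    (ET <= \sum_(i < k | (i < q)%N) #|letters (Tb i)| %/ 2)%N.
Proof.
case: hdec => [_ cover _ _ trans rec tower quasi peri].
have r0 : (0%:E <= r)%E by apply: le_trans hr; rewrite lee_fin.
have hTb i : is_gGIET r (Tb i).
  by have [/quasi[_ []]|/peri[_ []]] := ltnP i q.
apply: card_le_bound => s us sM.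
have nthM (l : 'I_(size s)) : exists mu : probability (measurableTypeR R) R,
    is_nonatomic_ergodic_invariant T mu /\
    nth point s l = patch (fun=> 0%E) measurable mu.
  by have [mu hmu ->] := sM _ (mem_nth point (ltn_ord l)); exists mu.
have [mu hmu] := choice nthM.
have [g [mg PK gK]] := base_map_inverse r0 hT.
have domain l : exists i, mu l (~` (Rd i)) = 0%E.
  exact: (exists_domain r0 hT (hmu l).1 mg PK gK trans rec cover).
have [iota hiota] := choice domain.
(* [iota] assigns to each listed measure a domain carrying it, and [m i] counts the measures
   assigned to [Rd i]. *)
pose m i := #|[pred l | iota l == i]|.
have bound i : (m i * 2 <= #|letters (Tb i)|)%N.
  pose ev (l : 'I_(m i)) : 'I_(size s) := enum_val l.
  apply: (tower_bound r0 hT (mu := mu \o ev) (hTb i) (rec i).1 (tower i)).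
  - by move=> l; exact: (hmu (ev l)).1.
  - move=> l /=; have /eqP <- : iota (ev l) == i by exact: (enum_valP l).
    exact: hiota.
  (* Off the Borel sets all listed functions are 0, so distinct ones differ on some Borel set. *)
  - move=> l l' ll'; apply: contrapT => same; move: ll'; apply/negP; rewrite negbK.
    apply/eqP/enum_val_inj/val_inj/eqP => /=.
    rewrite -(nth_uniq point _ _ us)//; apply/eqP.
    rewrite (hmu (ev l)).2 (hmu (ev l')).2; apply/funext => E.
    rewrite /patch; case: ifPn => // /set_mem mE.
    by apply: contrapT => /eqP h; apply: same; exists E.
have -> : size s = (\sum_(i < k) m i)%N.
  rewrite -[LHS]card_ord -sum1_card (partition_big iota predT)//=.
  by apply: eq_bigr => i _; rewrite sum1_card.
rewrite (bigID (fun i : 'I_k => (i < q)%N))/= [X in (_ + X)%N]big1 ?addn0.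
  by apply: leq_sum => i _; rewrite leq_divRL.
(* Over a periodic domain the base has one interval, and [m i * 2 <= 1] leaves no measure. *)
move=> i; rewrite -leqNgt => /peri[_ [card1 _ _ _]]; have := bound i.
by rewrite card1; case: (m i).
Qed.
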